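(* Let $M$ be an oriented $n$-manifold and let $\sigma\colon M\times(-\varepsilon,\varepsilon)\to\mathbb H^{n+1}$ be a smooth map such that $\sigma_t=\sigma(\cdot,t)$ is an immersion with small principal curvatures for all $t$, with normal vector field $\nu_t$. Let $f\colon M\times(-\varepsilon,\varepsilon)\to\mathbb R$ be a smooth map such that $$\frac{d}{dt}\sigma_t=f_t\nu_t,$$ and let $\zeta_t\colon M\to T^1\mathbb H^{n+1}$ be the lift of $\sigma_t$ and $G_t\colon M\to\mathbb G_{n+1}$ its Gauss map. Then $$\frac{d}{dt}\zeta_t=-d\zeta_t(B_t(\overline\nabla^tf_t))-\mathrm J(d\zeta_t(\overline\nabla^tf_t))+f_t\chi,$$ $$\frac{d}{dt}G_t=-dG_t(B_t(\overline\nabla^tf_t))-\mathbb J(dG_t(\overline\nabla^tf_t)),$$ where $\overline\nabla^tf_t$ is the gradient of $f_t$ with respect to the first fundamental form $\overline{\mathrm I}_t=G_t^*\mathbf g$ and $B_t$ is the shape operator of $\sigma_t$.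
   Context: $\mathbb H^{n+1}=\{x\in\mathbb R^{n+1,1}\mid\langle x,x\rangle=-1,\ x_{n+2}>0\}$ with $\langle x,y\rangle=\sum_{i\le n+1}x_iy_i-x_{n+2}y_{n+2}$; $T^1\mathbb H^{n+1}=\{(x,v)\mid x\in\mathbb H^{n+1},\ \langle x,v\rangle=0,\ \langle v,v\rangle=1\}$. $\mathbb G_{n+1}$ is the $2n$-manifold of oriented maximal unparametrized geodesics of $\mathbb H^{n+1}$, and $\mathrm p\colon T^1\mathbb H^{n+1}\to\mathbb G_{n+1}$ sends $(x,v)$ to the oriented geodesic through $x$ tangent to $v$; it is the quotient by the geodesic flow $\varphi_t(x,v)=(\cosh t\,x+\sinh t\,v,\ \sinh t\,x+\cosh t\,v)$, with generator $\chi_{(x,v)}=(v,x)$. For $w\in T_x\mathbb H^{n+1}$ with $\langle w,v\rangle=0$, let $w^{\mathcal H}=(w,0)$ and $w^{\mathcal V}=(0,w)$ in $T_{(x,v)}T^1\mathbb H^{n+1}$, and let $\chi^\perp_{(x,v)}$ be the span of such vectors; $\mathrm J$ is the endomorphism of $\chi^\perp_{(x,v)}$ with $\mathrm J(w^{\mathcal H})=w^{\mathcal V}$, $\mathrm J(w^{\mathcal V})=w^{\mathcal H}$. $d\mathrm p$ restricts to an isomorphism $\chi_{(x,v)}^\perp\to T_{\mathrm p(x,v)}\mathbb G_{n+1}$, and on $\mathbb G_{n+1}$ one (well) defines $\mathbf g(d\mathrm p(w_1^{\mathcal H}+u_1^{\mathcal V}),d\mathrm p(w_2^{\mathcal H}+u_2^{\mathcal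 V}))=\langle w_1,w_2\rangle-\langle u_1,u_2\rangle$ and $\mathbb J\circ d\mathrm p=d\mathrm p\circ\mathrm J$ on $\chi^\perp$. For an immersion $\sigma$ of an oriented $n$-manifold into $\mathbb H^{n+1}$, $\nu$ is the unit normal field compatible with the orientations, the lift is $\zeta_\sigma=(\sigma,\nu)$ (its differential takes values in $\chi^\perp$), the Gauss map is $G_\sigma=\mathrm p\circ\zeta_\sigma$, and the shape operator $B$ is defined by $d\sigma(B(W))=-D_W\nu$, $D$ the Levi-Civita connection of $\mathbb H^{n+1}$. Small principal curvatures means that the eigenvalues of $B$ lie in $(-1,1)$ everywhere; then $G_\sigma^*\mathbf g$ is a Riemannian metric. *)

(* Defs.v *)
From HB Require Import structures.
From mathcomp Require Import all_boot all_order all_algebra.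
From mathcomp Require Import all_classical all_reals all_analysis.

Set Implicit Arguments.
Unset Strict Implicit.
Unset Printing Implicit Defensive.

Import Order.TTheory GRing.Theory Num.Theory.
Import numFieldNormedType.Exports.

Local Open Scope classical_set_scope.
Local Open Scope ring_scope.

(** ** Smooth functions between normed spaces *)

Section Smooth.
Context {R : realType} {V W : normedModType R}.

(* Meant for [U] open. *)
Fixpoint Ck (k : nat) (U : set V) (f : V -> W) : Prop :=
  if k is k'.+1 then
    (forall x, U x -> differentiable f x) /\ (forall v, Ck k' U ('D_v f))
  else forall x, U x -> {for x, continuous f}.

Definition smooth_on (U : set V) (f : V -> W) : Prop := forall k, Ck k U f.

Definition smooth_near (x : V) (f : V -> W) : Prop :=
  exists U : set V, [/\ open U, U x & smooth_on U f].

(* [g] is a smooth extension, near [x], of the restriction of [f] to [A]. *)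
Definition is_smooth_extension (A : set V) (x : V) (f g : V -> W) : Prop :=
  smooth_near x g /\ (\forall y \near x, A y -> f y = g y).

Definition smooth_near_within (A : set V) (x : V) (f : V -> W) : Prop :=
  exists g, is_smooth_extension A x f g.

Definition smooth_extension (A : set V) (x : V) (f : V -> W) : V -> W :=
  xget f [set g | is_smooth_extension A x f g].

End Smooth.

(** ** Tangent vectors as derivations *)

(* [S] is the set of functions that are smooth near a point [p] of [T].  A
   tangent vector at [p] is a derivation of [S] at [p]; it is extended by [0] to
   the functions outside [S], so that equality of tangent vectors is equality of
   derivations.  The Leibniz rule already forces functions that agree near [p] to
   have the same image: multiply their difference by the indicator function of a
   neighbourhood of [p] on which they agree. *)
Definition derivations {R : realType} {T : Type} (S : set (T -> R)) (p : T) :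
    set ((T -> R) -> R) :=
  [set D | [/\ forall (a : R) g h, S g -> S h ->
                 D (fun x => a * g x + h x) = a * D g + D h,
               forall g h, S g -> S h ->
                 D (fun x => g x * h x) = D g * h p + g p * D h
             & forall g, ~ S g -> D g = 0]].

(** ** Oriented smooth manifolds *)

Record chart (R : realType) (n : nat) (M : topologicalType) := Chart {
  chart_dom : set M;
  chart_map : M -> 'rV[R]_n;
  chart_inv : 'rV[R]_n -> M }.

Section Charts.
Context {R : realType} {n : nat} {M : topologicalType}.
Implicit Types c : chart R n M.

Definition chart_range c : set 'rV[R]_n := chart_map c @` chart_dom c.

Definition is_chart c : Prop :=
  [/\ open (chart_dom c), open (chart_range c),
      forall p, chart_dom c p -> chart_inv c (chart_map c p) = p,
      {within chart_dom c, continuous (chart_map c)}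
    & {within chart_range c, continuous (chart_inv c)}].

Definition transition c c' : 'rV[R]_n -> 'rV[R]_n :=
  fun u => chart_map c' (chart_inv c u).

Definition positively_compatible c c' : Prop :=
  let U := chart_map c @` (chart_dom c `&` chart_dom c') in
  smooth_on U (transition c c') /\
  (forall u, U u -> 0 < \det ('J (transition c c') u)).

End Charts.

(* The orientation is the one for which all the charts of the atlas are
   positive. *)
Record oriented_manifold (R : realType) (n : nat) := OrientedManifold {
  carrier :> topologicalType;
  manifold_hausdorff : hausdorff_space carrier;
  manifold_second_countable : @second_countable carrier;
  atlas : set (chart R n carrier);
  atlas_chart : forall c, atlas c -> is_chart c;
  atlas_cover : forall p : carrier, exists2 c, atlas c & chart_dom c p;
  atlas_compatible : forall c c', atlas c -> atlas c' ->
    positively_compatible c c' }.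

Section Manifold.
Context {R : realType} {n : nat} {M : oriented_manifold R n}.

Definition smooth_germ (p : M) : set (M -> R) :=
  [set h : M -> R | exists2 c : chart R n M, atlas c & chart_dom c p /\
           smooth_near (chart_map c p) (h \o chart_inv c)].

Definition tangent (p : M) : set ((M -> R) -> R) :=
  derivations (smooth_germ p) p.

Definition coord_vector (c : chart R n M) (p : M) (i : 'I_n) : (M -> R) -> R :=
  fun h => if `[< smooth_germ p h >]
           then 'D_(delta_mx 0 i) (h \o chart_inv c) (chart_map c p) else 0.

Definition dvec {m : nat} (F : M -> 'rV[R]_m) (X : (M -> R) -> R) : 'rV[R]_m :=
  \row_i X (fun p => F p 0 i).

(* Smoothness on [M * ]-eps, eps[ ]; values at other times are irrelevant. *)
Definition smooth_family {W : normedModType R} (eps : R) (F : M -> R -> W) :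
    Prop :=
  forall c : chart R n M, atlas c ->
    smooth_on [set ut : 'rV[R]_n * R | chart_range c ut.1 /\ - eps < ut.2 < eps]
              (fun ut => F (chart_inv c ut.1) ut.2).

End Manifold.

(** ** Hyperbolic space, its unit tangent bundle and its space of geodesics *)

Section Hyperbolic.
Context {R : realType} {n : nat}.
Local Notation E := 'rV[R]_n.+2.
Implicit Types (x v w : E) (q X : E * E).

Definition mink x v : R :=
  \sum_(i < n.+1) x 0 (lift ord_max i) * v 0 (lift ord_max i)
  - x 0 ord_max * v 0 ord_max.

Definition hyperboloid : set E :=
  [set x | mink x x = -1 /\ 0 < x 0 ord_max].

Definition T1H : set (E * E) :=
  [set q | [/\ hyperboloid q.1, mink q.1 q.2 = 0 & mink q.2 q.2 = 1]].

Definition flow (t : R) q : E * E :=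
  let ch := (expR t + expR (- t)) / 2 in
  let sh := (expR t - expR (- t)) / 2 in
  (ch *: q.1 + sh *: q.2, sh *: q.1 + ch *: q.2).

Definition chi q : E * E := (q.2, q.1).

Definition hor w : E * E := (w, 0).
Definition ver w : E * E := (0, w).

Definition horizontal_vector q w : Prop := mink q.1 w = 0 /\ mink w q.2 = 0.

Definition chi_perp q : set (E * E) :=
  [set X | exists w u,
     [/\ horizontal_vector q w, horizontal_vector q u & X = hor w + ver u]].

(* On [chi_perp q]: [Jmap (hor w) = ver w] and [Jmap (ver w) = hor w]. *)
Definition Jmap X : E * E := (X.2, X.1).

(* An oriented unparametrized geodesic is represented by the set of its unit
   tangent vectors, that is, by an orbit of the geodesic flow. *)
Definition geodesic : Type := set (E * E).

Definition geod q : geodesic := [set flow t q | t in [set: R]].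

Definition geodesics : set geodesic := geod @` T1H.

(* Quotient smooth structure: [geod] being open and constant along the flow,
   [h] is smooth near [g] iff [h \o geod] is smooth near the fibre over [g]. *)
Definition geod_germ (g : geodesic) : set (geodesic -> R) :=
  [set h : geodesic -> R | forall q, T1H q -> geod q = g ->
           smooth_near_within T1H q (h \o geod)].

(* For [X] tangent to [T1H] at [q] the derivative does not depend on the chosen
   extension. *)
Definition dgeod q X : (geodesic -> R) -> R :=
  fun h => if `[< geod_germ (geod q) h >]
           then 'D_X (smooth_extension T1H q (h \o geod)) q else 0.

(* A unit tangent vector of [g], and the preimage in [chi_perp] of a tangent
   vector of the space of geodesics; [gmetric] and [JJ] below do not depend on
   the choice of the former. *)
Definition base (g : geodesic) : E * E :=
  xget 0 [set q | T1H q /\ geod q = g].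

Definition perp_lift (g : geodesic) (xi : (geodesic -> R) -> R) : E * E :=
  xget 0 [set X | chi_perp (base g) X /\ dgeod (base g) X = xi].

Definition gmetric (g : geodesic) (xi1 xi2 : (geodesic -> R) -> R) : R :=
  let X1 := perp_lift g xi1 in
  let X2 := perp_lift g xi2 in
  mink X1.1 X2.1 - mink X1.2 X2.2.

Definition JJ (g : geodesic) (xi : (geodesic -> R) -> R) :
    (geodesic -> R) -> R :=
  dgeod (base g) (Jmap (perp_lift g xi)).

(* [xi] is the velocity at time [t] of the curve [c] of geodesics. *)
Definition has_velocity (c : R -> geodesic) (t : R)
    (xi : (geodesic -> R) -> R) : Prop :=
  forall h, geod_germ (c t) h -> is_derive t 1 (fun s => h (c s)) (xi h).

(* Orientation of the hyperboloid: [b] is a positive basis of the tangent space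
   at [x] iff [b 0, ..., b n, x] is a positive basis of the ambient space. *)
Definition positive_frame x (b : 'I_n.+1 -> E) : Prop :=
  0 < \det (\matrix_(i < n.+2) oapp b x (unlift ord_max i)).

(* Orthogonal projection onto the tangent space of the hyperboloid at [x]. *)
Definition hyp_proj x v : E := v + mink v x *: x.

End Hyperbolic.

(** ** Hypersurfaces of the hyperbolic space *)

Section Hypersurface.
Context {R : realType} {n : nat} {M : oriented_manifold R n}.
Local Notation E := 'rV[R]_n.+2.
Implicit Types (s nu : M -> E) (p : M) (X Y : (M -> R) -> R).

Definition immersion s : Prop :=
  forall p X, tangent p X -> dvec s X = 0 -> X = (fun=> 0).

Definition unit_normal s nu : Prop :=
  forall p,
  [/\ mink (s p) (nu p) = 0, mink (nu p) (nu p) = 1,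
      forall X, tangent p X -> mink (nu p) (dvec s X) = 0
    & forall c : chart R n M, atlas c -> chart_dom c p ->
        positive_frame (s p) (fun j =>
          oapp (fun i => dvec s (coord_vector c p i)) (nu p)
               (unlift ord_max j))].

(* Levi-Civita derivative in the hyperbolic space of a field [Y] along [s]. *)
Definition levi_civita s (Y : M -> E) p X : E := hyp_proj (s p) (dvec Y X).

Definition shape_operator s nu p X : (M -> R) -> R :=
  xget (fun=> 0)
    [set Y | tangent p Y /\ dvec s Y = - levi_civita s nu p X].

Definition small_principal_curvatures s nu : Prop :=
  forall p X (lambda : R), tangent p X -> X <> (fun=> 0) ->
    shape_operator s nu p X = (fun h => lambda * X h) -> -1 < lambda < 1.

Definition lift_map s nu p : E * E := (s p, nu p).

Definition dlift s nu X : E * E := (dvec s X, dvec nu X).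

Definition gauss s nu p : geodesic := geod (lift_map s nu p).

Definition dgauss s nu p X : (geodesic -> R) -> R :=
  fun h => if `[< geod_germ (gauss s nu p) h >]
           then X (h \o gauss s nu) else 0.

(* The pull-back by the Gauss map of the metric on the space of geodesics. *)
Definition gauss_form s nu p X Y : R :=
  gmetric (gauss s nu p) (dgauss s nu p X) (dgauss s nu p Y).

Definition gauss_gradient s nu (f : M -> R) p : (M -> R) -> R :=
  xget (fun=> 0)
    [set X | tangent p X /\
             forall Y, tangent p Y -> gauss_form s nu p X Y = Y f].

End Hypersurface.

(* Main.v *)
Require Import Defs.
From HB Require Import structures.
From mathcomp Require Import all_boot all_order all_algebra.
From mathcomp Require Import all_classical all_reals all_analysis.
From mathcomp Require Import ring lra.
Set Implicit Arguments.
Unset Strict Implicit.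
Unset Printing Implicit Defensive.
Import Order.TTheory GRing.Theory Num.Theory.
Import numFieldNormedType.Exports.
Local Open Scope classical_set_scope.
Local Open Scope ring_scope.

(** The heart of the matter is the velocity [d] of the unit normal at a fixed
    point.  Differentiating <nu, nu> = 1 and <sigma, nu> = 0 in time gives
    <d, nu> = 0 and <d, sigma> = - f; differentiating <nu, d_i sigma> = 0 in time
    and exchanging the time derivative with the space derivative d_i gives
    <d, d_i sigma> = - d_i f ([normal_evolution]).  The vectors d_i sigma, nu and
    sigma form a basis and the Minkowski form is nondegenerate, so that [d] is
    determined: it is f sigma minus the image under d sigma of the gradient of f
    for the first fundamental form I of sigma.  On the other hand the pull-back
    of the metric by the Gauss map is I - III ([gauss_formE]), which by
    self-adjointness of B means that the gradient for I is (1 - B^2) X, where X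
    is the gradient for the pull-back.  As d sigma (B X) = - d nu (X), this is
    the second component of the first formula ([normal_velocity_eq]); the first
    component is the evolution equation of sigma.

    The gradient X exists because I - III is nondegenerate: if B^2 X = X, then
    X + B X satisfies B Z = Z, hence vanishes, as 1 is not an eigenvalue; then
    B X = - X, hence X vanishes, as -1 is not an eigenvalue
    ([first_minus_third_nondegenerate]).

    Differentiating the unit normal requires its smoothness: it is the normalized
    Lorentz dual of the vector of cofactors of the moving frame, hence a smooth
    function of the first derivatives of sigma ([unit_normal_cofactor],
    [unit_normal_smooth]).

    Tangent vectors of M are derivations.  That the coordinate vectors span them
    follows from the immersion property: d sigma is injective on derivations, and
    takes values in the orthogonal of sigma and nu, of which the d_i sigma are a
    basis ([tangent_span]).

    For the second formula, the projection to the space of geodesics is applied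
    to the first one.  It kills the generator of the flow ([dgeod_chi]), and it
    is injective on the orthogonal of the flow, because the Pluecker coordinates
    of a geodesic are smooth functions that separate its tangent vectors
    ([dgeod_inj]).  Since the flow preserves the orthogonal, the quadratic form
    and the map J, the metric and the almost product structure of the space of
    geodesics can be computed at the point of the lift rather than at the chosen
    base point of the geodesic ([gmetric_dgeod], [JJ_dgeod]). *)

(** * Calculus of functions of class Ck *)

Section Near.
Context {R : realType} {V W : normedModType R}.

(** The expansion of [g] at the point is that of [f], so the differential of
    [f], which is determined by the expansion, is also the one of [g]. *)
Lemma near_eq_differentiable (f g : V -> W) (x : V) :
  (\near x, f x = g x) -> differentiable f x -> differentiable g x.
Proof.
move=> fg df.
have E : g \o shift x = cst (g x) + 'd f x +o_ 0 id.
  apply/eqaddoP => e e0; have := df => /diff_locally /eqaddoP /(_ e e0) He.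
  have := fg; rewrite (near_shift 0) => fg0.
  have gx : g x = f x by rewrite (nbhs_singleton fg).
  near=> h.
  have -> : (g \o shift x - (cst (g x) + 'd f x)) h =
            (f \o shift x - (cst (f x) + 'd f x)) h.
    rewrite !fctE /= gx.
    have : (f \o shift (x - 0)) h = (g \o shift (x - 0)) h by near: h.
    by rewrite /= subr0 => ->.
  by near: h.
have dfc : continuous ('d f x) by apply: diff_continuous.
by apply/diff_locallyP; rewrite (diff_unique dfc E).
Unshelve. all: by end_near. Qed.

End Near.

Section CkBasics.
Context {R : realType} {V W : normedModType R}.
Implicit Types (f g : V -> W) (U : set V).

Lemma open_near U x : open U -> U x -> \forall y \near x, U y.
Proof. by move=> oU Ux; apply: open_nbhs_nbhs. Qed.

Lemma Ck_subset k (A B : set V) f : A `<=` B -> Ck k B f -> Ck k A f.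
Proof.
move=> AB; elim: k f => [|k IH] f /=; first by move=> H x /AB; exact: H.
by move=> [H1 H2]; split=> [x /AB|v]; [exact: H1|exact: IH].
Qed.

(** Openness makes the two functions agree near each point of the set, so that
    their derivatives agree on the set too, which lets the induction proceed. *)
Lemma Ck_eq k U f g : open U -> (forall x, U x -> f x = g x) ->
  Ck k U f -> Ck k U g.
Proof.
move=> oU; elim: k f g => [|k IH] f g fg /=.
  move=> H x Ux; have fgx := fg _ Ux.
  change (g @ x --> g x); rewrite -fgx; apply: cvg_trans (H x Ux); apply: near_eq_cvg.
  by apply: filterS (open_near oU Ux) => y; exact: fg.
move=> [H1 H2]; split=> [x Ux|v].
  apply: near_eq_differentiable (H1 x Ux).
  by apply: filterS (open_near oU Ux) => y; exact: fg.
apply: IH (H2 v) => x Ux; apply: near_eq_derive.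
by apply: filterS (open_near oU Ux) => y; exact: fg.
Qed.

Lemma CkW k U f : Ck k.+1 U f -> Ck k U f.
Proof.
elim: k f => [|k IH] f [H1 H2].
  by move=> x Ux; apply: differentiable_continuous; exact: H1.
by split=> // v; exact: IH.
Qed.

Lemma Ck_cst k U (w : W) : Ck k U (fun=> w).
Proof.
elim: k w => [|k IH] w; first by move=> x _; exact: cvg_cst.
split=> [x _|v]; first exact: differentiable_cst.
have -> : 'D_v (fun=> w) = (fun=> 0) :> (V -> W).
  by apply/funext => x; exact: derive_cst.
exact: IH.
Qed.

Lemma CkD k U f g : open U -> Ck k U f -> Ck k U g -> Ck k U (fun x => f x + g x).
Proof.
move=> oU; elim: k f g => [|k IH] f g Hf Hg.
  by move=> x Ux; apply: continuousD; [exact: Hf|exact: Hg].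
have [f1 f2] := Hf; have [g1 g2] := Hg.
split=> [x Ux|v]; first by apply: differentiableD; [exact: f1|exact: g1].
apply: Ck_eq (IH _ _ (f2 v) (g2 v)) => // x Ux.
by rewrite -deriveD //; apply: diff_derivable; [exact: f1|exact: g1].
Qed.

Lemma Ck_sum k U (I : Type) (r : seq I) (P : pred I) (F : I -> V -> W) :
  open U -> (forall i, Ck k U (F i)) -> Ck k U (fun x => \sum_(i <- r | P i) F i x).
Proof.
move=> oU HF; elim: r => [|i r IH].
  apply: Ck_eq (Ck_cst k U 0) => // x _; by rewrite big_nil.
case Pi : (P i); last first.
  by apply: Ck_eq IH => // x _; rewrite big_cons Pi.
by apply: Ck_eq (CkD oU (HF i) IH) => // x _; rewrite big_cons Pi.
Qed.

Lemma is_diff_linear (L : V -> W) : linear L -> continuous L ->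
  forall y, is_diff y L L.
Proof.
move=> Llin Lc y.
pose LM := GRing.isLinear.Build _ _ _ _ L Llin.
pose LL : {linear V -> W} := HB.pack L LM.
have -> : L = LL by [].
apply: DiffDef; first exact/linear_differentiable.
by rewrite diff_lin.
Qed.

End CkBasics.

Lemma linear_is_diff (R : realType) (V W : normedModType R) (L : V -> W) :
  (forall y, is_diff y L L) -> linear L.
Proof.
move=> H a u v; have [_ E] := H 0; move: (linearP ('d L 0) a u v).
by rewrite E.
Qed.

Section CkComp.
Context {R : realType}.
Implicit Types V W Z : normedModType R.

Lemma Ck_post_linear V W Z k (U : set V) (L : W -> Z) (f : V -> W) :
  open U -> (forall y, is_diff y L L) -> Ck k U f -> Ck k U (fun x => L (f x)).
Proof.
move=> oU HL; elim: k f => [|k IH] f Hf.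
  move=> x Ux; apply: continuous_comp; first exact: Hf.
  by apply: differentiable_continuous; apply: ex_diff; exact: HL.
have [f1 f2] := Hf; have dL y : differentiable L y by apply: ex_diff.
split=> [x Ux|v]; first by apply: differentiable_comp; [exact: f1|exact: dL].
apply: Ck_eq (IH _ (f2 v)) => // x Ux.
rewrite [RHS]deriveE; last by apply: differentiable_comp; [exact: f1|exact: dL].
rewrite diff_comp ?diff_val //=; last exact: f1.
by rewrite deriveE //; exact: f1.
Qed.

Lemma CkM V k (U : set V) (f g : V -> R) : open U ->
  Ck k U f -> Ck k U g -> Ck k U (fun x => f x * g x).
Proof.
move=> oU; elim: k f g => [|k IH] f g Hf Hg.
  by move=> x Ux; apply: continuousM; [exact: Hf|exact: Hg].
have [f1 f2] := Hf; have [g1 g2] := Hg.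
split=> [x Ux|v]; first by apply: differentiableM; [exact: f1|exact: g1].
apply: Ck_eq (CkD oU (IH _ _ (CkW Hf) (g2 v)) (IH _ _ (CkW Hg) (f2 v))) => // x Ux.
rewrite (_ : (fun x => f x * g x) = f * g) // deriveM //.
  by apply: diff_derivable; exact: f1.
by apply: diff_derivable; exact: g1.
Qed.

Lemma Ck_prod V k (U : set V) (I : Type) (r : seq I) (P : pred I)
    (F : I -> V -> R) :
  open U -> (forall i, P i -> Ck k U (F i)) -> Ck k U (fun x => \prod_(i <- r | P i) F i x).
Proof.
move=> oU HF; elim: r => [|i r IH].
  by apply: Ck_eq (Ck_cst k U (1 : R)) => // x _; rewrite big_nil.
case Pi : (P i); last first.
  by apply: Ck_eq IH => // x _; rewrite big_cons Pi.
by apply: Ck_eq (CkM oU (HF i Pi) IH) => // x _; rewrite big_cons Pi.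
Qed.

(** A basis with its dual basis of coordinate functions; it serves to write the
    chain rule with scalar coefficients. *)
Definition coordinates W (I : finType) (e : I -> W) (l : I -> W -> R) : Prop :=
  (forall i y, is_diff y (l i) (l i)) /\ (forall w, w = \sum_i l i w *: e i).

Definition finite_dim W : Prop :=
  exists (I : finType) (e : I -> W) (l : I -> W -> R), coordinates e l.

Lemma Ck_scalel V W k (U : set V) (f : V -> R) (w : W) :
  open U -> Ck k U f -> Ck k U (fun x => f x *: w).
Proof.
move=> oU Hf.
have H y : is_diff y ( *:%R^~ w : R -> W) ( *:%R^~ w : R -> W).
  exact: is_diff_scalel.
have := @Ck_post_linear _ R W k U ( *:%R^~ w).
by move/(_ f oU H Hf).
Qed.

Lemma Ck_coordinates V W k (U : set V) (I : finType) (e : I -> W)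
    (l : I -> W -> R) (f : V -> W) : open U -> coordinates e l ->
  (forall i, Ck k U (fun x => l i (f x))) -> Ck k U f.
Proof.
move=> oU [_ Hl] H; apply: Ck_eq (_ : Ck k U (fun x => \sum_i l i (f x) *: e i)) => //.
by apply: Ck_sum => // i; exact: Ck_scalel.
Qed.

(** The chain rule, expanded in coordinates of the intermediate space: each term
    is a product of lower order data, as needed by the induction in [Ck_comp]. *)
Lemma derive_coordinates V W (I : finType) (e : I -> W)
    (l : I -> W -> R) (f : V -> W) (g : W -> R) x v : coordinates e l ->
  differentiable f x -> differentiable g (f x) ->
  'D_v (fun x => g (f x)) x = \sum_i l i ('D_v f x) * 'D_(e i) g (f x).
Proof.
move=> [_ Hl] df dg; rewrite deriveE; last exact: differentiable_comp.
rewrite diff_comp //= (_ : 'd f x v = 'D_v f x) ?deriveE //.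
rewrite [in LHS](Hl ('d f x v)) linear_sum.
by apply: eq_bigr => i _; rewrite linearZ /= deriveE.
Qed.

(** By the chain rule in coordinates, the derivatives of a composition are sums of
    products of functions to which the induction hypothesis applies. *)
Lemma Ck_comp V W k (U : set V) (U' : set W) (f : V -> W) (g : W -> R) :
  finite_dim W -> open U -> (forall x, U x -> U' (f x)) ->
  Ck k U f -> Ck k U' g -> Ck k U (fun x => g (f x)).
Proof.
move=> [I [e [l Hl]]] oU UU'; elim: k f g UU' => [|k IH] f g UU' Hf Hg.
  move=> x Ux; apply: continuous_comp; first exact: Hf.
  by apply: Hg; exact: UU'.
have [f1 f2] := Hf; have [g1 g2] := Hg.
split=> [x Ux|v].
  by apply: differentiable_comp; [exact: f1|apply: g1; exact: UU'].
apply: Ck_eq (_ : Ck k U (fun x => \sum_i l i ('D_v f x) * 'D_(e i) g (f x))) => //.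
  by move=> x Ux; rewrite (derive_coordinates _ Hl) //; [exact: f1|apply: g1; exact: UU'].
apply: Ck_sum => // i; apply: CkM => //.
  by apply: Ck_post_linear (f2 v) => // y; exact: Hl.1.
apply: IH (g2 _) => //; exact: CkW.
Qed.

Lemma coordinates_R : coordinates (fun _ : unit => 1 : R) (fun _ => id).
Proof.
split=> [_ y|w]; first exact: is_diff_id.
by rewrite (big_pred1 tt) ?[_ *: _]mulr1 //; case.
Qed.

Lemma coordinates_rV m :
  coordinates (fun i : 'I_m => delta_mx 0 i : 'rV[R]_m) (fun i w => w 0 i).
Proof.
split=> [i y|w]; last exact: row_sum_delta.
apply: is_diff_linear; first by move=> a u v; rewrite !mxE.
exact: coord_continuous.
Qed.

Lemma coordinates_pair W Z (I J : finType) (e : I -> W) l (e' : J -> Z) l' :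
  coordinates e l -> coordinates e' l' ->
  coordinates (fun k : I + J => match k with inl i => (e i, 0) | inr j => (0, e' j) end
               : W * Z)
    (fun k w => match k with inl i => l i w.1 | inr j => l' j w.2 end).
Proof.
move=> [Hl le] [Hl' le']; split=> [[i|j] y|[w z]].
- apply: is_diff_linear.
    have lin : linear (l i) := linear_is_diff (Hl i).
    by move=> a u v /=; rewrite lin.
  move=> u; apply: continuous_comp; first exact: cvg_fst.
  by apply: differentiable_continuous; apply: ex_diff; exact: Hl.
- apply: is_diff_linear.
    have lin : linear (l' j) := linear_is_diff (Hl' j).
    by move=> a u v /=; rewrite lin.
  move=> u; apply: continuous_comp; first exact: cvg_snd.
  by apply: differentiable_continuous; apply: ex_diff; exact: Hl'.
rewrite big_sumType /=.
have E1 u : \sum_i l i u *: (e i, 0) = (u, 0) :> W * Z.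
  rewrite [in RHS](le u); elim/big_rec2: _ => // i a b _ ->.
  exact: (congr1 (pair _) (etrans (addr0 _) (scaler0 _ _))).
have E2 u : \sum_i l' i u *: (0, e' i) = (0, u) :> W * Z.
  rewrite [in RHS](le' u); elim/big_rec2: _ => // i a b _ ->.
  exact: (congr1 (pair^~ _) (etrans (addr0 _) (scaler0 _ _))).
by rewrite E1 E2; congr (_, _); rewrite /= ?addr0 ?add0r.
Qed.

Lemma finite_dim_pair W Z : finite_dim W -> finite_dim Z -> finite_dim (W * Z)%type.
Proof.
move=> [I [e [l H]]] [J [e' [l' H']]].
by do 3 eexists; exact: coordinates_pair H H'.
Qed.

Lemma finite_dim_R : finite_dim R.
Proof. by do 3 eexists; exact: coordinates_R. Qed.

Lemma finite_dim_rV m : finite_dim 'rV[R]_m.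
Proof. by do 3 eexists; exact: coordinates_rV. Qed.

End CkComp.

Section Rsqrt.
Context {R : realType} {V : normedModType R}.

Definition rsqrt (y : R) : R := (Num.sqrt y)^-1.

Lemma is_derive_rsqrt (y : R) : 0 < y ->
  is_derive y 1 rsqrt (- 2^-1 * (rsqrt y) ^+ 3).
Proof.
move=> y0; have s0 : Num.sqrt y != 0 by rewrite sqrtr_eq0 -ltNge.
apply: is_derive_eq.
  exact: (is_deriveV s0 (is_derive1_sqrt y0)).
rewrite /rsqrt /GRing.scale /=; field; exact: s0.
Qed.

(** The derivative of y^(-1/2) is - y^(-3/2) / 2, a polynomial in y^(-1/2) itself:
    the induction closes on this single function. *)
Lemma Ck_rsqrt k (U : set V) (g : V -> R) : open U ->
  (forall x, U x -> 0 < g x) -> Ck k U g -> Ck k U (fun x => rsqrt (g x)).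
Proof.
move=> oU g0; elim: k => [|k IH] Hg.
  move=> x Ux; apply: (@continuous_comp _ _ _ g rsqrt x); first exact: Hg.
  apply: differentiable_continuous; apply/derivable1_diffP.
  by case: (is_derive_rsqrt (g0 x Ux)).
have [g1 g2] := Hg.
have dr x : U x -> differentiable rsqrt (g x).
  by move=> Ux; apply/derivable1_diffP; case: (is_derive_rsqrt (g0 x Ux)).
split=> [x Ux|v].
  by apply: (@differentiable_comp _ _ _ _ g rsqrt); [exact: g1|exact: dr].
have Hr := IH (CkW Hg).
have H := CkM oU (CkM oU (CkM oU Hr Hr) Hr) (CkM oU (g2 v) (Ck_cst k U (- 2^-1 : R))).
apply: Ck_eq H => // x Ux.
rewrite (derive_coordinates _ (@coordinates_R R)); [|exact: g1|exact: dr].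
rewrite (big_pred1 tt); last by case.
have [_ ->] := is_derive_rsqrt (g0 x Ux).
by ring.
Qed.

End Rsqrt.

Section SecondDerivatives.
Context {R : realType} {V : normedModType R}.

Lemma common_neighbour_dist (a b c e : R) :
  `|a - c| < e / 2 -> `|b - c| < e / 2 -> `|a - b| <= e.
Proof.
move=> ac bc; rewrite (_ : a - b = (a - c) - (b - c)); last by ring.
by rewrite (le_trans (ler_normB _ _)) // (splitr e) lerD // ltW.
Qed.

Lemma same_increment (a b h c d d0 d1 : R) : h != 0 ->
  d - d0 - (d1 - c) = a * h * h -> d - d1 - (d0 - c) = b * h * h -> a = b.
Proof.
move=> hn E1 E2; apply: (mulIf hn); apply: (mulIf hn); rewrite -E1 -E2; ring.
Qed.

Lemma continuous_dist_lt (g : V -> R) (x : V) (e : R) :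
  {for x, continuous g} -> 0 < e -> \forall y \near x, `|g x - g y| < e.
Proof. by move=> /cvgrPdist_lt H e0; exact: H. Qed.

Lemma is_derive_line (W : normedModType R) (F : V -> W) (y v : V) (s : R) :
  derivable F (y + s *: v) v ->
  is_derive s 1 (fun s => F (y + s *: v)) ('D_v F (y + s *: v)).
Proof.
have E : (fun h : R => h^-1 *: (F (y + (h *: 1 + s) *: v) - F (y + s *: v))) =
         (fun h : R => h^-1 *: (F (h *: v + (y + s *: v)) - F (y + s *: v))).
  apply/funext => h; congr (_ *: (F _ - _)).
  have h1 : h *: (1 : R) = h := mulr1 h.
  by rewrite h1 scalerDl addrCA.
by move=> dF; apply: DeriveDef; [rewrite /derivable /= E|rewrite /derive /= E].
Qed.

(** The mean value theorem, applied in the direction [v] to a difference in the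
    direction [w], then in the direction [w] to the derivative along [v]. *)
Lemma mixed_increment (U : set V) (F : V -> R) (x v w : V) (h : R) : 0 < h ->
  Ck 2 U F ->
  (forall s t, 0 <= s <= h -> 0 <= t <= h -> U (x + s *: v + t *: w)) ->
  exists s t, [/\ 0 <= s <= h, 0 <= t <= h &
    F (x + h *: v + h *: w) - F (x + h *: v) - (F (x + h *: w) - F x) =
    'D_w ('D_v F) (x + s *: v + t *: w) * h * h].
Proof.
move=> h0 [F1 F2] HU.
have U0 s : 0 <= s <= h -> U (x + s *: v).
  by move=> sh; have := HU s 0 sh; rewrite scale0r addr0 lexx ltW //; exact.
pose phi s := F (x + s *: v + h *: w) - F (x + s *: v).
have dphi (s : R) : 0 <= s <= h ->
    is_derive s 1 phi ('D_v F (x + s *: v + h *: w) - 'D_v F (x + s *: v)).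
  move=> sh; apply: is_deriveB; last first.
    by apply: is_derive_line; apply: diff_derivable; apply: F1; exact: U0.
  have E z : x + z *: v + h *: w = (x + h *: w) + z *: v by rewrite addrAC.
  rewrite E; under [X in is_derive _ _ X]eq_fun do rewrite E.
  apply: is_derive_line; apply: diff_derivable; apply: F1.
  by rewrite -E; apply: HU => //; rewrite lexx ltW.
have [s sh Es] : exists2 s, s \in `]0, h[ & phi h - phi 0 =
    ('D_v F (x + s *: v + h *: w) - 'D_v F (x + s *: v)) * (h - 0).
  apply: (@MVT _ phi (fun s => 'D_v F (x + s *: v + h *: w) - 'D_v F (x + s *: v))).
    exact: h0.
    by move=> z; rewrite in_itv /= => /andP[z0 zh]; apply: dphi; rewrite !ltW.
  apply: derivable_within_continuous => z; rewrite in_itv /= => zh.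
  by have [] := dphi z zh.
have {}sh : 0 <= s <= h by move: sh; rewrite in_itv /= => /andP[? ?]; rewrite !ltW.
pose psi t := 'D_v F (x + s *: v + t *: w).
have dpsi (t : R) : 0 <= t <= h ->
    is_derive t 1 psi ('D_w ('D_v F) (x + s *: v + t *: w)).
  move=> th; apply: is_derive_line; apply: diff_derivable.
  by apply: (F2 v).1; exact: HU.
have [t th Et] : exists2 t, t \in `]0, h[ & psi h - psi 0 =
    'D_w ('D_v F) (x + s *: v + t *: w) * (h - 0).
  apply: (@MVT _ psi (fun t => 'D_w ('D_v F) (x + s *: v + t *: w))); first exact: h0.
    by move=> z; rewrite in_itv /= => /andP[z0 zh]; apply: dpsi; rewrite !ltW.
  apply: derivable_within_continuous => z; rewrite in_itv /= => zh.
  by have [] := dpsi z zh.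
exists s, t; split=> //.
  by move: th; rewrite in_itv /= => /andP[? ?]; rewrite !ltW.
have -> : F (x + h *: v + h *: w) - F (x + h *: v) - (F (x + h *: w) - F x) =
  phi h - phi 0 by rewrite /phi scale0r addr0.
move: Et; rewrite /psi scale0r addr0 subr0 => Et.
by rewrite Es Et subr0.
Qed.

(** The mixed increment is symmetric in the two directions, so by
    [mixed_increment] both iterated derivatives take a common value at points
    close to [x]; continuity at [x] concludes. *)
Lemma derive_comm (U : set V) (F : V -> R) (x v w : V) :
  open U -> U x -> Ck 2 U F -> 'D_w ('D_v F) x = 'D_v ('D_w F) x.
Proof.
move=> oU Ux HF; have [F1 F2] := HF.
have c1 : {for x, continuous ('D_w ('D_v F))} by exact: ((F2 v).2 w x Ux).
have c2 : {for x, continuous ('D_v ('D_w F))} by exact: ((F2 w).2 v x Ux).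
apply/eqP; rewrite -subr_eq0 -normr_le0; apply/ler_addgt0Pr => e e0; rewrite add0r.
have e2 : 0 < e / 2 by rewrite divr_gt0.
have near_good : \forall y \near x, [/\ U y,
    `|'D_w ('D_v F) x - 'D_w ('D_v F) y| < e / 2 &
    `|'D_v ('D_w F) x - 'D_v ('D_w F) y| < e / 2].
  have n1 := continuous_dist_lt c1 e2; have n2 := continuous_dist_lt c2 e2.
  by apply: filterS3 (open_near oU Ux) n1 n2 => y Uy y1 y2; exact: And3 Uy y1 y2.
have /nbhs_normP[r /= r0 Hr] := near_good.
(* The constant 1 keeps the denominator positive when both directions vanish. *)
pose h := r / (2 * (`|v| + `|w| + 1)).
have N0 : 0 < `|v| + `|w| + 1 by rewrite ltr_wpDl // addr_ge0.
have h0 : 0 < h by rewrite divr_gt0 // mulr_gt0.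
have hr : h * (`|v| + `|w|) < r.
  rewrite /h mulrAC ltr_pdivrMr ?mulr_gt0 // ltr_pM2l //.
  by have := normr_ge0 v; have := normr_ge0 w; lra.
have good s t : 0 <= s <= h -> 0 <= t <= h -> ball_ Num.norm x r (x + s *: v + t *: w).
  move=> /andP[s0 sh] /andP[t0 th]; rewrite /ball_ /= -addrA opprD addNKr normrN.
  apply: le_lt_trans hr; apply: le_trans (ler_normD _ _) _.
  by rewrite !normrZ mulrDr !ger0_norm // lerD // ler_wpM2r.
have goodU s t : 0 <= s <= h -> 0 <= t <= h -> U (x + s *: v + t *: w).
  by move=> sh th; have [] := Hr _ (good s t sh th).
have goodU' s t : 0 <= s <= h -> 0 <= t <= h -> U (x + s *: w + t *: v).
  by move=> sh th; rewrite addrAC; exact: goodU.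
have [s [t [sh th E1]]] := mixed_increment h0 HF goodU.
have [t' [s' [th' sh' E2]]] := mixed_increment h0 HF goodU'.
have E : 'D_w ('D_v F) (x + s *: v + t *: w) = 'D_v ('D_w F) (x + t' *: w + s' *: v).
  have hn : h != 0 by rewrite gt_eqF.
  by rewrite (addrAC x) in E2; exact: same_increment hn E1 E2.
have [_ A1 _] := Hr _ (good s t sh th).
have [_ _ A2] := Hr _ (good s' t' sh' th').
rewrite (addrAC x) -E in A2.
exact: common_neighbour_dist A1 A2.
Qed.

End SecondDerivatives.

(** * Derivatives of curves, and the Minkowski form *)

Section DeriveTools.
Context {R : realType}.
Implicit Types V W Z : normedModType R.

Lemma is_derive_cvgP V W (f : V -> W) x v d :
  is_derive x v f d <-> h^-1 *: (f (h *: v + x) - f x) @[h --> 0^'] --> d.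
Proof.
split=> [[df <-]|H]; first exact: df.
by apply: DeriveDef; [apply/cvg_ex; exists d|exact: cvg_lim].
Qed.

Lemma is_derive_pair V W Z (f : V -> W) (g : V -> Z) x v a b :
  is_derive x v f a -> is_derive x v g b ->
  is_derive x v (fun y => (f y, g y) : W * Z) (a, b).
Proof.
by move=> /is_derive_cvgP fa /is_derive_cvgP gb; apply/is_derive_cvgP; exact: cvg_pair.
Qed.

Lemma is_derive_rVP V m (f : V -> 'rV[R]_m) x v d :
  is_derive x v f d <-> forall i, is_derive x v (fun y => f y 0 i) (d 0 i).
Proof.
split=> [[df <-] i|H].
  have fi := (derivable_mxP _ _ _).1 df 0 i.
  by apply: DeriveDef => //; rewrite derive_mx // mxE.
have df : derivable f x v.
  by apply/derivable_mxP => i j; rewrite ord1; have [] := H j.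
apply: DeriveDef => //; apply/rowP => i; rewrite derive_mx // mxE.
by have [_] := H i.
Qed.

Lemma is_derive_fsum V W (I : finType) (P : pred I) (F : I -> V -> W) (d : I -> W) x v :
  (forall i, P i -> is_derive x v (F i) (d i)) ->
  is_derive x v (fun y => \sum_(i | P i) F i y) (\sum_(i | P i) d i).
Proof.
move=> H.
have -> : (fun y => \sum_(i | P i) F i y) = \sum_(i | P i) F i.
  by apply/funext => y; rewrite fct_sumE.
elim/big_ind2: _ => [|? ? ? ? ? ?|//]; [exact: is_derive_cst|exact: is_deriveD].
Qed.

Lemma is_derive_mul V (f g : V -> R) x v a b :
  is_derive x v f a -> is_derive x v g b ->
  is_derive x v (fun y => f y * g y) (a * g x + f x * b).
Proof.
move=> fa gb; have := is_deriveM fa gb.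
by rewrite addrC (_ : g x *: a = a * g x) //; exact: mulrC.
Qed.

Lemma is_derive_scaler V m (f : V -> R) (g : V -> 'rV[R]_m) x v a b :
  is_derive x v f a -> is_derive x v g b ->
  is_derive x v (fun y => f y *: g y) (a *: g x + f x *: b).
Proof.
move=> fa /is_derive_rVP gb; apply/is_derive_rVP => i; rewrite !mxE.
have E : (fun y => (f y *: g y) 0 i) = (fun y => f y * g y 0 i).
  by apply/funext => y; rewrite mxE.
by rewrite E; exact: is_derive_mul.
Qed.

Lemma is_derive_comp V W Z (f : V -> W) (g : W -> Z) x v :
  differentiable f x -> differentiable g (f x) ->
  is_derive x v (fun y => g (f y)) ('D_('D_v f x) g (f x)).
Proof.
move=> df dg; have dgf : differentiable (g \o f) x by exact: differentiable_comp.
apply: DeriveDef; first exact: diff_derivable.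
by rewrite (deriveE _ dgf) diff_comp //= !deriveE.
Qed.

Lemma is_derive_comp1 W Z (f : R -> W) (g : W -> Z) (s : R) d :
  is_derive s 1 f d -> differentiable g (f s) ->
  is_derive s 1 (fun y => g (f y)) ('D_d g (f s)).
Proof.
move=> fd dg; have [df E] := fd.
have := is_derive_comp (1 : R) ((derivable1_diffP _ _).1 df) dg.
by rewrite E.
Qed.

Lemma is_derive_continuous1 W (f : R -> W) (s : R) d :
  is_derive s 1 f d -> {for s, continuous f}.
Proof.
by move=> [df _]; apply: differentiable_continuous; apply/derivable1_diffP.
Qed.

Lemma continuous_gt0 (f : R -> R) (s : R) : {for s, continuous f} -> 0 < f s ->
  \forall y \near s, 0 < f y.
Proof.
move=> fc f0; have /cvgrPdist_lt /(_ _ f0) := fc.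
apply: filterS => y; rewrite ltr_norml => /andP[_].
by rewrite ltrBlDr ltrDl.
Qed.

Lemma derive_linear_dir V W (f : V -> W) x u v a : differentiable f x ->
  'D_(a *: u + v) f x = a *: 'D_u f x + 'D_v f x.
Proof. by move=> df; rewrite !deriveE // linearP. Qed.

End DeriveTools.

Section Mink.
Context {R : realType} {n : nat}.
Local Notation E := 'rV[R]_n.+2.
Implicit Types (x y z v w : E).

Lemma minkC x y : mink x y = mink y x.
Proof.
rewrite /mink mulrC; congr (_ - _).
by apply: eq_bigr => i _; rewrite mulrC.
Qed.

Lemma mink_linearl a x y z : mink (a *: x + y) z = a * mink x z + mink y z.
Proof.
rewrite /mink !mxE mulrBr !mulrDl mulr_sumr -mulrA.
rewrite [RHS]addrACA -opprD -big_split /=; congr (_ - _).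
by apply: eq_bigr => i _; rewrite !mxE mulrDl mulrA.
Qed.

Lemma mink0l z : mink 0 z = 0.
Proof. by have := mink_linearl (-1) 0 0 z; rewrite scaler0 addr0 => ->; ring. Qed.

Lemma minkZl a x z : mink (a *: x) z = a * mink x z.
Proof. by rewrite -[a *: x]addr0 mink_linearl mink0l addr0. Qed.

Lemma minkDl x y z : mink (x + y) z = mink x z + mink y z.
Proof. by rewrite -[x]scale1r mink_linearl scale1r mul1r. Qed.

Lemma minkNl x z : mink (- x) z = - mink x z.
Proof. by rewrite -scaleN1r minkZl mulN1r. Qed.

Lemma minkBl x y z : mink (x - y) z = mink x z - mink y z.
Proof. by rewrite minkDl minkNl. Qed.

Lemma minkZr a x z : mink z (a *: x) = a * mink z x.
Proof. by rewrite minkC minkZl minkC. Qed.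

Lemma minkDr x y z : mink z (x + y) = mink z x + mink z y.
Proof. by rewrite minkC minkDl !(minkC z). Qed.

Lemma minkNr x z : mink z (- x) = - mink z x.
Proof. by rewrite minkC minkNl minkC. Qed.

Lemma minkBr x y z : mink z (x - y) = mink z x - mink z y.
Proof. by rewrite minkDr minkNr. Qed.

Lemma mink_suml (I : finType) (F : I -> E) z :
  mink (\sum_i F i) z = \sum_i mink (F i) z.
Proof.
by elim/big_rec2: _ => [|i a b _ <-]; [exact: mink0l|rewrite minkDl].
Qed.

Definition minkE := (minkDl, minkDr, minkZl, minkZr, minkNl, minkNr).

Lemma is_derive_mink (V : normedModType R) (F G : V -> E) (p d : V) a b :
  is_derive p d F a -> is_derive p d G b ->
  is_derive p d (fun r => mink (F r) (G r)) (mink a (G p) + mink (F p) b).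
Proof.
move=> /is_derive_rVP Fa /is_derive_rVP Gb.
rewrite /mink addrACA -opprD -big_split /=.
apply: is_deriveB; last exact: is_derive_mul.
by apply: is_derive_fsum => i _; exact: is_derive_mul.
Qed.

Lemma Ck_mink (V : normedModType R) k (U : set V) (F G : V -> E) : open U ->
  (forall i, Ck k U (fun p => F p 0 i)) -> (forall i, Ck k U (fun p => G p 0 i)) ->
  Ck k U (fun p => mink (F p) (G p)).
Proof.
move=> oU HF HG; apply: CkD => //.
  by apply: Ck_sum => // i; exact: CkM.
have H := CkM oU (Ck_cst k U (-1 : R)) (CkM oU (HF ord_max) (HG ord_max)).
by apply: Ck_eq H => // x _; rewrite mulN1r.
Qed.

(** Since the velocity is orthogonal to the initial point, the normalizing factor
    has zero derivative at 0, and normalizing does not change the velocity.  Taking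
    [c] equal to 1 or to -1 covers spacelike and timelike curves. *)
Lemma normalized_curve (c : R) (P : R -> E) p w :
  c * mink p p = 1 -> mink p w = 0 -> P 0 = p -> is_derive (0 : R) 1 P w ->
  let Q s := rsqrt (c * mink (P s) (P s)) *: P s in
  [/\ Q 0 = p, is_derive (0 : R) 1 Q w &
      \forall s \near (0 : R), 0 < rsqrt (c * mink (P s) (P s)) /\ c * mink (Q s) (Q s) = 1].
Proof.
move=> cp pw P0 dP Q.
have r1 : rsqrt (1 : R) = 1 by rewrite /rsqrt sqrtr1 invr1.
have dc : is_derive (0 : R) 1 (fun s => c * mink (P s) (P s)) 0.
  apply: (is_derive_eq (is_derive_mul (is_derive_cst c (0 : R) 1) (is_derive_mink dP dP))).
  by rewrite P0 mul0r add0r pw minkC pw addr0 mulr0.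
have dr : is_derive (0 : R) 1 (fun s => rsqrt (c * mink (P s) (P s))) 0.
  have c0 : 0 < c * mink (P 0) (P 0) by rewrite P0 cp.
  have := @is_derive1_comp _ _ (fun s => c * mink (P s) (P s)) _ _ _ (is_derive_rsqrt c0) dc.
  by rewrite mulr0.
split.
- by rewrite /Q P0 cp r1 scale1r.
- apply: (is_derive_eq (is_derive_scaler dr dP)).
  by rewrite scale0r add0r P0 cp r1 scale1r.
have /continuous_gt0 : {for 0, continuous (fun s => c * mink (P s) (P s))}.
  exact: is_derive_continuous1.
rewrite P0 cp => /(_ ltr01); apply: filterS => s s0.
have sq0 : Num.sqrt (c * mink (P s) (P s)) != 0 by rewrite sqrtr_eq0 -ltNge.
split; first by rewrite invr_gt0 sqrtr_gt0.
rewrite /Q !minkE mulrCA [X in _ * X]mulrCA.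
rewrite -[X in _ * (_ * X)](sqr_sqrtr (ltW s0)) /rsqrt; field; exact: sq0.
Qed.

End Mink.

(** * Smoothness at a point *)

Section MoreCk.
Context {R : realType}.
Implicit Types V W Z : normedModType R.

Lemma diff_is_derive V W (f : V -> W) x v : differentiable f x ->
  is_derive x v f ('D_v f x).
Proof. by move=> df; apply: derivableP; exact: diff_derivable. Qed.

Lemma Ck_id V k (U : set V) : open U -> Ck k U (fun y : V => y).
Proof.
move=> oU; case: k => [|k]; first by move=> y _; exact: cvg_id.
split=> [y _|v]; first exact: ex_diff.
apply: Ck_eq (Ck_cst k U v) => [|y _]; first exact: oU.
by rewrite derive_id.
Qed.

Lemma Ck_pair V W Z k (U : set V) (f : V -> W) (g : V -> Z) : open U ->
  Ck k U f -> Ck k U g -> Ck k U (fun x => (f x, g x)).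
Proof.
move=> oU; elim: k f g => [|k IH] f g Hf Hg.
  by move=> x Ux; apply: cvg_pair; [exact: Hf|exact: Hg].
have [f1 f2] := Hf; have [g1 g2] := Hg.
split=> [x Ux|v]; first by apply: differentiable_pair; [exact: f1|exact: g1].
apply: Ck_eq (IH _ _ (f2 v) (g2 v)) => // x Ux.
have df := diff_is_derive v (f1 x Ux).
have dg := diff_is_derive v (g1 x Ux).
by have [_ ->] := is_derive_pair df dg.
Qed.

Lemma Ck_entry V m k (U : set V) (f : V -> 'rV[R]_m) i : open U ->
  Ck k U f -> Ck k U (fun x => f x 0 i).
Proof.
move=> oU Hf; have [H _] := @coordinates_rV R m.
exact: (Ck_post_linear oU (H i) Hf).
Qed.

Lemma smooth_near_differentiable V W (x : V) (f : V -> W) :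
  smooth_near x f -> differentiable f x.
Proof. by move=> [U [_ Ux /(_ 1%N) [H _]]]; exact: H. Qed.

Lemma smooth_near_linear V (a : R) (x : V) (f g : V -> R) :
  smooth_near x f -> smooth_near x g -> smooth_near x (fun y => a * f y + g y).
Proof.
move=> [U [oU Ux fU]] [A [oA Ax gA]]; exists (U `&` A).
have oUA : open (U `&` A) by exact: openI.
split=> // k; apply: CkD => //; last by apply: Ck_subset (gA k) => y [].
apply: CkM => //; first exact: Ck_cst.
by apply: Ck_subset (fU k) => y [].
Qed.

Lemma smooth_nearM V (x : V) (f g : V -> R) :
  smooth_near x f -> smooth_near x g -> smooth_near x (fun y => f y * g y).
Proof.
move=> [U [oU Ux fU]] [A [oA Ax gA]]; exists (U `&` A).
have oUA : open (U `&` A) by exact: openI.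
split=> // k; apply: CkM => //.
  by apply: Ck_subset (fU k) => y [].
by apply: Ck_subset (gA k) => y [].
Qed.

Lemma smooth_near_cst V W (x : V) (a : W) : smooth_near x (fun=> a).
Proof. by exists setT; split=> //; [exact: openT|move=> k; exact: Ck_cst]. Qed.

Lemma continuous_on_preimage (V W : topologicalType) (U : set V) (A : set W) (f : V -> W) :
  open U -> (forall x, U x -> {for x, continuous f}) -> open A -> open (U `&` f @^-1` A).
Proof.
move=> oU fc oA; apply: (continuous_inP f oU).1 => // x; rewrite inE; exact: fc.
Qed.

Lemma smooth_near_comp V W (x : V) (U : set V) (f : V -> W) (g : W -> R) : finite_dim W ->
  open U -> U x -> smooth_on U f -> smooth_near (f x) g -> smooth_near x (fun y => g (f y)).
Proof.
move=> fW oU Ux fU [A [oA Ax gA]]; exists (U `&` f @^-1` A).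
have oUA : open (U `&` f @^-1` A).
  by apply: continuous_on_preimage => // y Uy; exact: (fU 0%N).
split=> // k; apply: (@Ck_comp _ _ _ k _ A) => //; first by move=> y [].
by apply: Ck_subset (fU k) => y [].
Qed.

Lemma smooth_near_eq V W (x : V) (U : set V) (f g : V -> W) : open U -> U x ->
  (forall y, U y -> f y = g y) -> smooth_near x f -> smooth_near x g.
Proof.
move=> oU Ux fg [A [oA Ax fA]]; exists (U `&` A).
have oUA : open (U `&` A) by exact: openI.
split=> // k; apply: (@Ck_eq _ _ _ _ _ f) => //; first by move=> y [/fg].
by apply: Ck_subset (fA k) => y [].
Qed.

End MoreCk.

(** * Curves in the unit tangent bundle, and the geodesic flow *)

Section UnitTangentBundle.
Context {R : realType} {n : nat}.
Local Notation E := 'rV[R]_n.+2.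
Implicit Types (q X : E * E) (h : @geodesic R n -> R) (g : E * E -> R).

(** Realizing vectors by curves is what shows that derivatives along them depend
    only on the restriction of functions to the unit tangent bundle. *)
Definition T1H_velocity q X : Prop :=
  exists c : R -> E * E,
    [/\ c 0 = q, is_derive (0 : R) 1 c X & \forall s \near (0 : R), T1H (c s)].

(** The curve is obtained from the straight line through [q] with velocity [X] by
    the Gram-Schmidt process; orthogonality of the components of [X] to those of
    [q] ensures that the process does not alter the velocity. *)
Lemma chi_perp_velocity q X : T1H q -> chi_perp q X -> T1H_velocity q X.
Proof.
case: q => x v [[/= xx xpos] xv vv] [w [u [[/= xw wv] [/= xu uv] ->]]].
pose P s : E := x + s *: w.
have line (a b : E) : is_derive (0 : R) 1 (fun s : R => a + s *: b) b.
  apply/is_derive_rVP => i.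
  have -> : (fun s : R => (a + s *: b) 0 i) = (fun s : R => a 0 i + s * b 0 i).
    by apply/funext => s; rewrite !mxE.
  apply: (is_derive_eq (is_deriveD (is_derive_cst (a 0 i) (0 : R) 1)
    (is_derive_mul (is_derive_id (0 : R) 1) (is_derive_cst (b 0 i) (0 : R) 1)))).
  by rewrite add0r mul1r mulr0 addr0.
have [Q0 dQ Qn] : [/\ rsqrt (-1 * mink (P 0) (P 0)) *: P 0 = x,
    is_derive (0 : R) 1 (fun s => rsqrt (-1 * mink (P s) (P s)) *: P s) w &
    \forall s \near (0 : R), 0 < rsqrt (-1 * mink (P s) (P s)) /\
      -1 * mink (rsqrt (-1 * mink (P s) (P s)) *: P s)
              (rsqrt (-1 * mink (P s) (P s)) *: P s) = 1].
  apply: normalized_curve => //; first by rewrite xx mulrNN mulr1.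
  by rewrite /P scale0r addr0.
pose Q s := rsqrt (-1 * mink (P s) (P s)) *: P s.
rewrite -/(Q 0) in Q0.
pose A s : E := v + s *: u.
have A0 : A 0 = v by rewrite /A scale0r addr0.
(* The sign is positive because [Q s] has square -1. *)
pose B s : E := A s + mink (A s) (Q s) *: Q s.
have B0 : B 0 = v by rewrite /B A0 Q0 (minkC v) xv scale0r addr0.
have dB : is_derive (0 : R) 1 B u.
  have dA : is_derive (0 : R) 1 A u := line v u.
  have dQ' : is_derive (0 : R) 1 Q w := dQ.
  apply: (is_derive_eq (is_deriveD dA (is_derive_scaler (is_derive_mink dA dQ') dQ'))).
  by rewrite A0 Q0 (minkC u) xu (minkC v w) wv (minkC v) xv addr0 !scale0r !addr0.
have [C0 dC Cn] : [/\ rsqrt (1 * mink (B 0) (B 0)) *: B 0 = v,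
    is_derive (0 : R) 1 (fun s => rsqrt (1 * mink (B s) (B s)) *: B s) u &
    \forall s \near (0 : R), 0 < rsqrt (1 * mink (B s) (B s)) /\
      1 * mink (rsqrt (1 * mink (B s) (B s)) *: B s)
              (rsqrt (1 * mink (B s) (B s)) *: B s) = 1].
  apply: normalized_curve => //; first by rewrite vv mul1r.
  by rewrite minkC.
pose C s := rsqrt (1 * mink (B s) (B s)) *: B s.
exists (fun s => (Q s, C s)); split.
- by rewrite Q0 /C C0.
- have dQ' : is_derive (0 : R) 1 Q w := dQ.
  have dC' : is_derive (0 : R) 1 C u := dC.
  apply: (is_derive_eq (is_derive_pair dQ' dC')).
  by rewrite /hor /ver; congr (_, _); rewrite /= ?addr0 ?add0r.
have Qp : \forall s \near (0 : R), 0 < Q s 0 ord_max.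
  apply: continuous_gt0; last by rewrite Q0.
  have /is_derive_rVP dQi : is_derive (0 : R) 1 Q w := dQ.
  exact: is_derive_continuous1 (dQi ord_max).
apply: filterS3 Qn Qp Cn => s [_ Qs] Qps [_ Cs].
have QQ : mink (Q s) (Q s) = -1.
  by move: Qs; rewrite -/(Q s) mulN1r => /eqP; rewrite eqr_oppLR => /eqP.
split=> /=; first by split.
- have QB : mink (Q s) (B s) = 0.
    by rewrite /B minkDr minkZr QQ (minkC (Q s)) mulrN1 subrr.
  by rewrite -/(Q s) minkZr QB mulr0.
- by move: Cs; rewrite -/(C s) mul1r.
Qed.

Lemma derive_velocity q X (g1 g2 : E * E -> R) : T1H_velocity q X ->
  differentiable g1 q -> differentiable g2 q ->
  (\forall y \near q, T1H y -> g1 y = g2 y) -> 'D_X g1 q = 'D_X g2 q.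
Proof.
move=> [c [c0 dc Tc]] d1 d2 g12.
have cc : {for 0, continuous c} by exact: is_derive_continuous1 dc.
rewrite -c0 in d1 d2 g12 *.
have [_ <-] := is_derive_comp1 dc d1.
have [_ <-] := is_derive_comp1 dc d2.
apply: near_eq_derive.
have Hc : \forall s \near (0 : R), T1H (c s) -> g1 (c s) = g2 (c s) := cc _ g12.
by apply: filterS2 Tc Hc => s Ts; exact.
Qed.

Definition cosh (t : R) : R := (expR t + expR (- t)) / 2.
Definition sinh (t : R) : R := (expR t - expR (- t)) / 2.

Lemma flowE t q : flow t q = (cosh t *: q.1 + sinh t *: q.2, sinh t *: q.1 + cosh t *: q.2).
Proof. by []. Qed.

Lemma cosh2_sinh2 t : cosh t * cosh t - sinh t * sinh t = 1.
Proof.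
have e : expR t * expR (- t) = 1 by rewrite expRN mulfV // gt_eqF // expR_gt0.
rewrite /cosh /sinh.
rewrite (_ : _ - _ = expR t * expR (- t)); first exact: e.
by field.
Qed.

Lemma coshD s t : cosh (s + t) = cosh s * cosh t + sinh s * sinh t.
Proof. by rewrite /cosh /sinh opprD !expRD; field. Qed.

Lemma sinhD s t : sinh (s + t) = sinh s * cosh t + cosh s * sinh t.
Proof. by rewrite /cosh /sinh opprD !expRD; field. Qed.

Lemma flow0 q : flow 0 q = q.
Proof.
rewrite flowE; case: q => x v.
have -> : cosh 0 = 1 by rewrite /cosh oppr0 expR0; field.
have -> : sinh 0 = 0 by rewrite /sinh oppr0 expR0; field.
by rewrite /= !scale1r !scale0r addr0 add0r.
Qed.

Lemma flowD s t q : flow s (flow t q) = flow (s + t) q.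
Proof.
rewrite !flowE coshD sinhD; congr (_, _) => /=;
  by apply/rowP => i; rewrite !mxE; ring.
Qed.

Lemma flow_linear t a q X : flow t (a *: q + X) = a *: flow t q + flow t X.
Proof.
rewrite !flowE; congr (_, _) => /=; by apply/rowP => i; rewrite !mxE; ring.
Qed.

Lemma flow_Jmap t X : Jmap (flow t X) = flow t (Jmap X).
Proof. by rewrite !flowE /Jmap /= addrC [in X in (_, X)]addrC. Qed.

Lemma geod_flow t q : geod (flow t q) = geod q.
Proof.
apply/seteqP; split=> y [s _ <-] /=.
  by exists (s + t) => //; rewrite flowD.
by exists (s - t) => //; rewrite flowD subrK.
Qed.

Lemma geod_eq_flow q q' : geod q' = geod q -> exists t, q' = flow t q.
Proof.
move=> e; have : geod q' q' by exists 0 => //; exact: flow0.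
by rewrite e => -[t _ <-]; exists t.
Qed.

Lemma mink_flow t (x v y w : E) :
  let q := flow t (x, v) in let X := flow t (y, w) in
  mink q.1 X.1 - mink q.2 X.2 = mink x y - mink v w.
Proof.
rewrite /= -/(cosh t) -/(sinh t) !minkE -[RHS]mul1r -(cosh2_sinh2 t).
by ring.
Qed.

Lemma chi_perpP q X : chi_perp q X <->
  horizontal_vector q X.1 /\ horizontal_vector q X.2.
Proof.
split=> [[w [u [hw hu ->]]]|[h1 h2]]; last first.
  exists X.1, X.2; split=> //; case: X h1 h2 => w u _ _.
  by rewrite /hor /ver; congr (_, _); rewrite /= ?addr0 ?add0r.
by rewrite /hor /ver /= addr0 add0r.
Qed.

Lemma chi_perp_flow t q X : chi_perp q X -> chi_perp (flow t q) (flow t X).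
Proof.
move=> /chi_perpP [[h1 h2] [h3 h4]]; apply/chi_perpP.
rewrite !flowE /horizontal_vector /= !minkE h1 h2 h3 h4.
have h5 : mink X.1 q.1 = 0 by rewrite minkC.
have h6 : mink X.2 q.1 = 0 by rewrite minkC.
have h7 : mink q.2 X.1 = 0 by rewrite minkC.
have h8 : mink q.2 X.2 = 0 by rewrite minkC.
by rewrite h5 h6 h7 h8 !(mulr0, addr0).
Qed.

Lemma chi_perp_Jmap q X : chi_perp q X -> chi_perp q (Jmap X).
Proof. by move=> /chi_perpP [h1 h2]; apply/chi_perpP. Qed.

Lemma chi_perp_comb q a X Y : chi_perp q X -> chi_perp q Y -> chi_perp q (a *: X + Y).
Proof.
move=> /chi_perpP [[h1 h2] [h3 h4]] /chi_perpP [[k1 k2] [k3 k4]]; apply/chi_perpP.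
by split; split; rewrite /= !minkE ?h1 ?h2 ?h3 ?h4 ?k1 ?k2 ?k3 ?k4 !(mulr0, addr0).
Qed.

Lemma is_derive_flow q : is_derive (0 : R) 1 (fun t => flow t q) (chi q).
Proof.
have dN : is_derive (0 : R) 1 (fun t : R => expR (- t)) (-1).
  have H : is_derive (- 0 : R) 1 expR 1.
    by rewrite oppr0 -[X in is_derive _ _ _ X]expR0; exact: is_derive_expR.
  by have := @is_derive1_comp _ expR -%R 0 _ _ H (is_deriveNid (0 : R) (1 : R)); rewrite mul1r.
have dP : is_derive (0 : R) 1 (fun t : R => expR t) 1.
  by rewrite -[X in is_derive _ _ _ X]expR0; exact: is_derive_expR.
have d2 := is_derive_cst (2^-1 : R) (0 : R) 1.
have dc : is_derive (0 : R) 1 cosh 0.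
  apply: (is_derive_eq (is_derive_mul (is_deriveD dP dN) d2)).
  by rewrite subrr mul0r mulr0 addr0.
have ds : is_derive (0 : R) 1 sinh 1.
  apply: (is_derive_eq (is_derive_mul (is_deriveB dP dN) d2)).
  by rewrite /cst; field.
have c0 : cosh 0 = 1 by rewrite /cosh oppr0 expR0; field.
have s0 : sinh 0 = 0 by rewrite /sinh oppr0 expR0; field.
case: q => x v; rewrite /chi /=.
have lin (a b : R -> R) (da db : R) (y z : E) : is_derive (0 : R) 1 a da ->
    is_derive (0 : R) 1 b db ->
    is_derive (0 : R) 1 (fun t => a t *: y + b t *: z) (da *: y + db *: z).
  move=> Ha Hb; apply: (is_derive_eq (is_deriveD (is_derive_scaler Ha (is_derive_cst y (0 : R) 1))
     (is_derive_scaler Hb (is_derive_cst z (0 : R) 1)))).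
  by rewrite !scaler0 !addr0.
apply: (is_derive_eq (is_derive_pair (lin _ _ _ _ x v dc ds) (lin _ _ _ _ x v ds dc))).
by rewrite !scale0r !scale1r add0r addr0.
Qed.

(** The equations of the unit tangent bundle are preserved by the flow.  The
    positivity of the last coordinate is assumed because, being an open condition,
    it is available wherever it is needed. *)
Lemma T1H_flow t q : T1H q -> 0 < (flow t q).1 0 ord_max -> T1H (flow t q).
Proof.
case: q => x v [[/= xx _] xv vv] pos.
have vx : mink v x = 0 by rewrite minkC.
split; first (split; last exact: pos); rewrite flowE /= !minkE xx vv xv vx;
  have := cosh2_sinh2 t; by lra.
Qed.

Lemma is_diff_flow t q : is_diff q (flow t : E * E -> E * E) (flow t).
Proof.
apply: is_diff_linear q; first exact: flow_linear.
move=> q; rewrite /continuous_at.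
have C (a b : R) : {for q, continuous (fun y : E * E => a *: y.1 + b *: y.2)}.
  apply: (@continuousD _ _ _ (fun y : E * E => a *: y.1) (fun y : E * E => b *: y.2)).
    apply: (@continuous_comp _ _ _ fst ( *:%R a : E -> E)).
      exact: cvg_fst.
    exact: scaler_continuous.
  apply: (@continuous_comp _ _ _ snd ( *:%R b : E -> E)).
    exact: cvg_snd.
  exact: scaler_continuous.
exact: cvg_pair (C (cosh t) (sinh t)) (C (sinh t) (cosh t)).
Qed.

Lemma last_coord_continuous : continuous (fun y : E * E => y.1 0 ord_max).
Proof.
move=> y; apply: (@continuous_comp _ _ _ fst (fun w : E => w 0 ord_max)).
  exact: cvg_fst.
exact: coord_continuous.
Qed.

Lemma last_coord_near t q : 0 < (flow t q).1 0 ord_max ->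
  \forall y \near q, 0 < (flow t y).1 0 ord_max.
Proof.
move=> pos.
have c1 : {for q, continuous (fun y => (flow t y).1 0 ord_max)}.
  have H : {for q, continuous (flow t : E * E -> E * E)}.
    by apply: differentiable_continuous; case: (is_diff_flow t q).
  exact: (@continuous_comp _ _ _ (flow t) (fun y : E * E => y.1 0 ord_max) q H
    (@last_coord_continuous _)).
have /cvgrPdist_lt /(_ _ pos) := c1.
apply: filterS => y; rewrite ltr_norml => /andP[_].
by rewrite ltrBlDr ltrDl.
Qed.

Lemma T1H_flow_near0 q : T1H q -> \forall t \near (0 : R), T1H (flow t q).
Proof.
move=> Tq.
have c1 : {for 0, continuous (fun t => (flow t q).1 0 ord_max)}.
  have H : {for 0, continuous (fun t => flow t q)}.
    exact: is_derive_continuous1 (is_derive_flow q).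
  exact: (@continuous_comp _ _ _ (fun t => flow t q) (fun y : E * E => y.1 0 ord_max) 0 H
    (@last_coord_continuous _)).
have := continuous_gt0 c1; rewrite flow0; case: (Tq) => -[_ q0] _ _ /(_ q0).
by apply: filterS => t; exact: T1H_flow.
Qed.

End UnitTangentBundle.

(** * Tangent vectors of the space of geodesics *)

Section GeodesicSpace.
Context {R : realType} {n : nat}.
Local Notation E := 'rV[R]_n.+2.
Implicit Types (q X Y : E * E) (h : @geodesic R n -> R).

Lemma near_everywhere (V : normedModType R) (x : V) (P : V -> Prop) :
  (forall y, P y) -> \forall y \near x, P y.
Proof. by move=> H; apply: nearW. Qed.

Lemma smooth_extensionP q h : T1H q -> geod_germ (geod q) h ->
  is_smooth_extension T1H q (h \o geod) (smooth_extension T1H q (h \o geod)).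
Proof.
move=> Tq hg.
by apply: (@xgetPex _ _ [set g | is_smooth_extension T1H q (h \o geod) g]); exact: hg.
Qed.

Lemma dgeodE q X h (g : E * E -> R) : T1H q -> T1H_velocity q X ->
  geod_germ (geod q) h -> differentiable g q ->
  (\forall y \near q, T1H y -> h (geod y) = g y) -> dgeod q X h = 'D_X g q.
Proof.
move=> Tq Xv hg dg hE; rewrite /dgeod; case: asboolP => // _.
have [sm hs] := smooth_extensionP Tq hg.
apply: derive_velocity => //; first exact: smooth_near_differentiable.
by apply: filterS2 hE hs => y H1 H2 Ty; rewrite -H1 // -H2.
Qed.

Lemma dgeod_linear q a X Y : T1H q ->
  dgeod q (a *: X + Y) = (fun h => a * dgeod q X h + dgeod q Y h).
Proof.
move=> Tq; apply/funext => h; rewrite /dgeod; case: asboolP => [hg|_]; last by rewrite mulr0 addr0.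
have [sm _] := smooth_extensionP Tq hg.
by rewrite derive_linear_dir //; exact: smooth_near_differentiable.
Qed.

(** Functions of geodesics are constant along the flow, whose velocity is [chi]. *)
Lemma dgeod_chi q : T1H q -> dgeod q (chi q) = (fun=> 0).
Proof.
move=> Tq; apply/funext => h; case: (asboolP (geod_germ (geod q) h)) => hg; last first.
  by rewrite /dgeod asboolF.
have [sm hs] := smooth_extensionP Tq hg.
have dg := smooth_near_differentiable sm.
rewrite /dgeod asboolT //.
set g := smooth_extension _ _ _ in sm hs dg *.
have dg0 : differentiable g (flow 0 q) by rewrite flow0.
have [_ ] := is_derive_comp1 (is_derive_flow q) dg0.
rewrite flow0 => <-.
transitivity ('D_1 (cst (h (geod q))) (0 : R)); last exact: derive_cst.
apply: near_eq_derive.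
have fc : {for 0, continuous (fun t => flow t q)}.
  exact: is_derive_continuous1 (is_derive_flow q).
have hs0 : \forall y \near flow 0 q, T1H y -> h (geod y) = g y by rewrite flow0.
have hsf : \forall t \near (0 : R), T1H (flow t q) ->
    h (geod (flow t q)) = g (flow t q) := fc _ hs0.
by apply: filterS2 (T1H_flow_near0 Tq) hsf => t Tt /(_ Tt); rewrite geod_flow.
Qed.

(** Near [q], a smooth extension around [flow t q] composed with the flow is an
    extension around [q], since functions of geodesics are constant along the flow. *)
Lemma dgeod_flow t q X h : T1H q -> T1H (flow t q) -> chi_perp q X ->
  dgeod (flow t q) (flow t X) h = dgeod q X h.
Proof.
move=> Tq Tf Xq; case: (asboolP (geod_germ (geod q) h)) => hg; last first.
  by rewrite /dgeod geod_flow asboolF.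
have hg' : geod_germ (geod (flow t q)) h by rewrite geod_flow.
have [sm hs] := smooth_extensionP Tf hg'.
have dg := smooth_near_differentiable sm.
set g := smooth_extension _ _ _ in sm hs dg.
have df : differentiable (flow t : E * E -> E * E) q by case: (is_diff_flow t q).
have fc : {for q, continuous (flow t : E * E -> E * E)} by exact: differentiable_continuous.
have Xv := chi_perp_velocity Tq Xq.
have Xv' := chi_perp_velocity Tf (chi_perp_flow t Xq).
rewrite (dgeodE Tf Xv' hg' dg hs).
rewrite (@dgeodE q X h (fun y => g (flow t y)) Tq Xv hg).
- have [_ ->] := is_derive_comp X df dg.
  by rewrite (deriveE _ df); case: (is_diff_flow t q) => _ ->.
- exact: (@differentiable_comp _ _ _ _ (flow t) g).
have hs' : \forall y \near q, T1H (flow t y) -> h (geod (flow t y)) = g (flow t y) := fc _ hs.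
have pos : 0 < (flow t q).1 0 ord_max by case: Tf => -[].
apply: filterS2 hs' (last_coord_near pos) => y Hy py Ty.
by rewrite -Hy ?geod_flow //; exact: T1H_flow.
Qed.

Lemma baseP q : T1H q -> T1H (base (geod q)) /\ geod (base (geod q)) = geod q.
Proof. by move=> Tq; apply: (@xgetPex _ _ [set y | T1H y /\ geod y = geod q]); exists q. Qed.

(** The coordinates of the bivector of a geodesic: they are invariant under the
    flow because cosh^2 - sinh^2 = 1, hence descend to the space of geodesics. *)
Definition plucker (i j : 'I_n.+2) q : R := q.1 0 i * q.2 0 j - q.1 0 j * q.2 0 i.

Lemma plucker_flow i j t q : plucker i j (flow t q) = plucker i j q.
Proof.
rewrite /plucker flowE /= !mxE -[RHS]mul1r -(cosh2_sinh2 t); ring.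
Qed.

Lemma plucker_geod i j q : T1H q -> plucker i j (base (geod q)) = plucker i j q.
Proof.
move=> /baseP [_ /geod_eq_flow[t ->]]; exact: plucker_flow.
Qed.

Lemma is_diff_entry1 (i : 'I_n.+2) q :
  is_diff q (fun y : E * E => y.1 0 i) (fun y : E * E => y.1 0 i).
Proof.
have [H _] := coordinates_pair (@coordinates_rV R n.+2) (@coordinates_rV R n.+2).
exact: (H (inl i) q).
Qed.

Lemma is_diff_entry2 (i : 'I_n.+2) q :
  is_diff q (fun y : E * E => y.2 0 i) (fun y : E * E => y.2 0 i).
Proof.
have [H _] := coordinates_pair (@coordinates_rV R n.+2) (@coordinates_rV R n.+2).
exact: (H (inr i) q).
Qed.

Lemma plucker_smooth i j : smooth_on [set: E * E] (plucker i j).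
Proof.
move=> k.
have Cid := @Ck_id _ (E * E)%type k _ openT.
have e1 i' := Ck_post_linear openT (is_diff_entry1 i') Cid.
have e2 i' := Ck_post_linear openT (is_diff_entry2 i') Cid.
have H := CkD openT (CkM openT (e1 i) (e2 j))
  (CkM openT (Ck_cst k setT (-1 : R)) (CkM openT (e1 j) (e2 i))).
by apply: Ck_eq H => [|y _]; [exact: openT|rewrite mulN1r].
Qed.

Lemma plucker_germ i j q : T1H q -> geod_germ (geod q) (fun g => plucker i j (base g)).
Proof.
move=> Tq q' Tq' _; exists (plucker i j); split.
  by exists setT; split=> //; [exact: openT|exact: plucker_smooth].
by apply: near_everywhere => y Ty /=; rewrite plucker_geod.
Qed.

Lemma derive_plucker i j q X : 'D_X (plucker i j) q =
  X.1 0 i * q.2 0 j + q.1 0 i * X.2 0 j - (X.1 0 j * q.2 0 i + q.1 0 j * X.2 0 i).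
Proof.
have d1 k : is_derive q X (fun y : E * E => y.1 0 k) (X.1 0 k).
  have [d E] := is_diff_entry1 k q; apply: DeriveDef; first exact: diff_derivable.
  by rewrite deriveE // E.
have d2 k : is_derive q X (fun y : E * E => y.2 0 k) (X.2 0 k).
  have [d E] := is_diff_entry2 k q; apply: DeriveDef; first exact: diff_derivable.
  by rewrite deriveE // E.
have [_ ->] // := is_deriveB (is_derive_mul (d1 i) (d2 j)) (is_derive_mul (d1 j) (d2 i)).
Qed.

(** The Pluecker coordinates being smooth functions of geodesics, the bivector
    w /\ v + x /\ u vanishes, where q = (x, v) and X = (w, u).  Contracting it with
    v gives w, and contracting it with x gives u. *)
Lemma dgeod_inj q X : T1H q -> chi_perp q X -> dgeod q X = (fun=> 0) -> X = 0.
Proof.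
move=> Tq Xq X0.
have P0 i j : X.1 0 i * q.2 0 j + q.1 0 i * X.2 0 j - (X.1 0 j * q.2 0 i + q.1 0 j * X.2 0 i) = 0.
  rewrite -derive_plucker -(@dgeodE q X (fun g => plucker i j (base g))) ?X0 //.
  - exact: chi_perp_velocity.
  - exact: plucker_germ.
  - apply: smooth_near_differentiable.
    by exists setT; split=> //; [exact: openT|exact: plucker_smooth].
  by apply: near_everywhere => y Ty; rewrite plucker_geod.
have comb i (z : E) : mink q.2 z * X.1 0 i + mink X.2 z * q.1 0 i
    - mink X.1 z * q.2 0 i - mink q.1 z * X.2 0 i = 0.
  rewrite -(mulrC (X.1 0 i)) -(mulrC (q.1 0 i)) -(mulrC (q.2 0 i)) -(mulrC (X.2 0 i)).
  have : mink (X.1 0 i *: q.2 + q.1 0 i *: X.2 - (q.2 0 i *: X.1 + X.2 0 i *: q.1)) z = 0.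
    rewrite (_ : _ - _ = 0) ?mink0l //; apply/rowP => j.
    by rewrite !mxE -[RHS](P0 i j) (mulrC (q.2 0 i)) (mulrC (X.2 0 i)).
  by rewrite !minkE => <-; ring.
move: Tq Xq => [[xx _] xv vv] /chi_perpP [[h1 h2] [h3 h4]].
have vx : mink q.2 q.1 = 0 by rewrite minkC.
have h1' : mink X.1 q.1 = 0 by rewrite minkC.
have h3' : mink X.2 q.1 = 0 by rewrite minkC.
have E1 : X.1 = 0.
  apply/rowP => i; rewrite mxE; have := comb i q.2.
  by rewrite vv h4 h2 xv; move=> <-; ring.
have E2 : X.2 = 0.
  apply/rowP => i; rewrite mxE; have := comb i q.1.
  by rewrite vx h1' h3' xx => <-; ring.
by case: X E1 E2 {X0 P0 comb h1 h2 h3 h4 h1' h3'} => a b /= -> ->.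
Qed.

(** By injectivity, the lift at the base point of the geodesic is the transport by
    the flow of the lift at [q]. *)
Lemma perp_lift_dgeod q X t : T1H q -> chi_perp q X ->
  base (geod q) = flow t q -> perp_lift (geod q) (dgeod q X) = flow t X.
Proof.
move=> Tq Xq bt; have [Tb _] := baseP Tq; rewrite /perp_lift bt.
have Tf : T1H (flow t q) by rewrite -bt.
apply: xget_unique => /=.
  split; first exact: chi_perp_flow.
  by apply/funext => h; exact: dgeod_flow.
move=> Y [Yq EY].
have Z0 : dgeod (flow t q) (-1 *: flow t X + Y) = (fun=> 0).
  rewrite dgeod_linear //; apply/funext => h; rewrite EY dgeod_flow //.
  by rewrite mulN1r addNr.
have := dgeod_inj Tf (chi_perp_comb (-1) (chi_perp_flow t Xq) Yq) Z0.
by rewrite scaleN1r addrC => /subr0_eq.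
Qed.

Lemma gmetric_dgeod q X Y : T1H q -> chi_perp q X -> chi_perp q Y ->
  gmetric (geod q) (dgeod q X) (dgeod q Y) = mink X.1 Y.1 - mink X.2 Y.2.
Proof.
move=> Tq Xq Yq; rewrite /gmetric.
have [t bt] := geod_eq_flow (baseP Tq).2.
rewrite (perp_lift_dgeod Tq Xq bt) (perp_lift_dgeod Tq Yq bt).
by case: X Xq => x v _; case: Y Yq => y w _; exact: mink_flow.
Qed.

Lemma JJ_dgeod q X : T1H q -> chi_perp q X ->
  JJ (geod q) (dgeod q X) = dgeod q (Jmap X).
Proof.
move=> Tq Xq; rewrite /JJ.
have [t b1] := geod_eq_flow (baseP Tq).2.
rewrite (perp_lift_dgeod _ _ b1) //; have [Tb _] := baseP Tq.
rewrite b1 in Tb *; rewrite flow_Jmap; apply/funext => h.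
by rewrite dgeod_flow //; exact: chi_perp_Jmap.
Qed.

End GeodesicSpace.

(** * Germs and derivations on a manifold *)

Section Germs.
Context {R : realType} {n : nat} {M : oriented_manifold R n}.
Implicit Types (c : chart R n M) (p : M) (h : M -> R) (X Y : (M -> R) -> R).

Lemma chart_range_open c : atlas c -> open (chart_range c).
Proof. by move=> /atlas_chart []. Qed.

Lemma chart_mapK c p : atlas c -> chart_dom c p -> chart_inv c (chart_map c p) = p.
Proof. by move=> /atlas_chart [_ _ H _ _]; exact: H. Qed.

Lemma chart_range_map c p : chart_dom c p -> chart_range c (chart_map c p).
Proof. by exists p. Qed.

Lemma chart_inv_continuous c u : atlas c -> chart_range c u ->
  {for u, continuous (chart_inv c)}.
Proof.
move=> /atlas_chart [_ oR _ _]; rewrite continuous_open_subspace // => H cu.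
by apply: H; rewrite inE.
Qed.

(** In the chart, the overlap is the preimage of an open set by the inverse chart. *)
Lemma overlap_open c c' : atlas c -> atlas c' ->
  open (chart_map c @` (chart_dom c `&` chart_dom c')).
Proof.
move=> ac ac'.
have -> : chart_map c @` (chart_dom c `&` chart_dom c') =
          chart_range c `&` chart_inv c @^-1` chart_dom c'.
  apply/seteqP; split=> u.
    by move=> [p [cp c'p] <-]; split; [exists p|rewrite /= chart_mapK].
  move=> [[p cp <-]] /=; rewrite chart_mapK // => c'p; by exists p.
apply: continuous_on_preimage; first exact: chart_range_open.
  by move=> u; exact: chart_inv_continuous.
by have [] := atlas_chart ac'.
Qed.

(** Smoothness is required in one chart only; the transition maps being smooth,
    it then holds in every chart. *)
Lemma smooth_germ_chart c p h : atlas c -> chart_dom c p -> smooth_germ p h ->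
  smooth_near (chart_map c p) (h \o chart_inv c).
Proof.
move=> ac cp [c' ac' [c'p hs]].
have [tr _] := atlas_compatible ac ac'.
have U0 : (chart_map c @` (chart_dom c `&` chart_dom c')) (chart_map c p) by exists p.
have hs' : smooth_near (transition c c' (chart_map c p)) (h \o chart_inv c').
  by rewrite /transition chart_mapK.
have := smooth_near_comp (finite_dim_rV _) (overlap_open ac ac') U0 tr hs'.
apply: (smooth_near_eq (overlap_open ac ac') U0) => u [q [cq c'q] <-] /=.
by rewrite /transition (chart_mapK ac cq) (chart_mapK ac' c'q).
Qed.

Lemma smooth_germ_linear p a h k : smooth_germ p h -> smooth_germ p k ->
  smooth_germ p (fun x => a * h x + k x).
Proof.
have [c ac cp] := atlas_cover p => hs ks; exists c => //; split=> //.
exact: (smooth_near_linear a (smooth_germ_chart ac cp hs) (smooth_germ_chart ac cp ks)).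
Qed.

Lemma smooth_germM p h k : smooth_germ p h -> smooth_germ p k ->
  smooth_germ p (fun x => h x * k x).
Proof.
have [c ac cp] := atlas_cover p => hs ks; exists c => //; split=> //.
exact: (smooth_nearM (smooth_germ_chart ac cp hs) (smooth_germ_chart ac cp ks)).
Qed.

Lemma smooth_germ_cst p (a : R) : smooth_germ p (fun=> a).
Proof.
have [c ac cp] := atlas_cover p; exists c => //; split=> //.
exact: smooth_near_cst.
Qed.

Lemma smooth_germD p h k : smooth_germ p h -> smooth_germ p k ->
  smooth_germ p (fun x => h x + k x).
Proof.
move=> hs ks; have := smooth_germ_linear 1 hs ks.
rewrite (_ : (fun x => 1 * h x + k x) = (fun x => h x + k x)) //.
by apply/funext => x; rewrite mul1r.
Qed.

Lemma smooth_germ_sum p (I : Type) (r : seq I) (F : I -> M -> R) :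
  (forall i, smooth_germ p (F i)) -> smooth_germ p (fun x => \sum_(i <- r) F i x).
Proof.
move=> H; elim: r => [|i r IH].
  rewrite (_ : (fun x => _) = (fun=> 0)); first exact: smooth_germ_cst.
  by apply/funext => x; rewrite big_nil.
rewrite (_ : (fun x => _) = (fun x => F i x + \sum_(i <- r) F i x)); first exact: smooth_germD.
by apply/funext => x; rewrite big_cons.
Qed.

Lemma tangentD p X h k : tangent p X -> smooth_germ p h -> smooth_germ p k ->
  X (fun x => h x + k x) = X h + X k.
Proof.
move=> [Xl _ _] hs ks; have := Xl 1 h k hs ks; rewrite mul1r => <-; congr X.
by apply/funext => x; rewrite mul1r.
Qed.

(** The Leibniz rule for 1 = 1 * 1 gives X 1 = 2 X 1. *)
Lemma tangent_cst p X (a : R) : tangent p X -> X (fun=> a) = 0.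
Proof.
move=> Xt; have [Xl XM _] := Xt.
have X1 : X (fun=> 1) = 0.
  have := XM _ _ (smooth_germ_cst p 1) (smooth_germ_cst p 1).
  rewrite !mulr1 mul1r => /eqP.
  by rewrite -subr_eq0 opprD addNKr oppr_eq0 => /eqP.
have X0 : X (fun=> 0) = 0.
  have := Xl (-1) _ _ (smooth_germ_cst p 1) (smooth_germ_cst p 1).
  rewrite X1 mulr0 addr0 => E; rewrite -[RHS]E; congr X.
  by apply/funext => x; rewrite mulr1 addNr.
have := Xl a _ _ (smooth_germ_cst p 1) (smooth_germ_cst p 0).
rewrite X1 X0 mulr0 !addr0 => E; rewrite -[RHS]E; congr X.
by apply/funext => x; rewrite mulr1.
Qed.

Lemma tangentN p X h : tangent p X -> smooth_germ p h -> X (fun x => - h x) = - X h.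
Proof.
move=> Xt hs; have [Xl _ _] := Xt.
have := Xl (-1) _ _ hs (smooth_germ_cst p 0).
rewrite (tangent_cst _ Xt) addr0 mulN1r => <-; congr X.
by apply/funext => x; rewrite mulN1r addr0.
Qed.

Lemma tangent_sum p X (I : Type) (r : seq I) (F : I -> M -> R) : tangent p X ->
  (forall i, smooth_germ p (F i)) ->
  X (fun x => \sum_(i <- r) F i x) = \sum_(i <- r) X (F i).
Proof.
move=> Xt H; elim: r => [|i r IH].
  rewrite big_nil -[RHS](tangent_cst 0 Xt); congr X.
  by apply/funext => x; rewrite big_nil.
rewrite big_cons -IH -(tangentD Xt) //; last exact: smooth_germ_sum.
by congr X; apply/funext => x; rewrite big_cons.
Qed.

Lemma tangentM p X h k : tangent p X -> smooth_germ p h -> smooth_germ p k ->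
  X (fun x => h x * k x) = X h * k p + h p * X k.
Proof. by move=> [_ XM _]; exact: XM. Qed.

Lemma tangent_comb p a X Y : tangent p X -> tangent p Y ->
  tangent p (fun h => a * X h + Y h).
Proof.
move=> [X1 X2 X3] [Y1 Y2 Y3]; split=> [b h k hs ks|h k hs ks|h hs].
- by rewrite X1 // Y1 //; ring.
- by rewrite X2 // Y2 //; ring.
- by rewrite X3 // Y3 // mulr0 addr0.
Qed.

Lemma tangent0 p : tangent p (fun=> 0).
Proof.
by split=> *; rewrite ?(mulr0, mul0r, addr0).
Qed.

Lemma tangent_lin p (I : finType) (a : I -> R) (X : I -> (M -> R) -> R) :
  (forall i, tangent p (X i)) -> tangent p (fun h => \sum_i a i * X i h).
Proof.
move=> H; elim: (index_enum I) => [|i r IH].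
  rewrite (_ : (fun h => _) = (fun=> 0)); first exact: tangent0.
  by apply/funext => h; rewrite big_nil.
rewrite (_ : (fun h => _) = (fun h => a i * X i h + \sum_(i <- r) a i * X i h)).
  exact: tangent_comb.
by apply/funext => h; rewrite big_cons.
Qed.

Lemma coord_vector_tangent c p i : atlas c -> chart_dom c p -> tangent p (coord_vector c p i).
Proof.
move=> ac cp.
have D h : smooth_germ p h -> differentiable (h \o chart_inv c) (chart_map c p).
  by move=> hs; apply: smooth_near_differentiable; exact: smooth_germ_chart.
split=> [a h k hs ks|h k hs ks|h hs].
- rewrite /coord_vector !asboolT //; last exact: smooth_germ_linear.
  have dh := diff_is_derive (delta_mx 0 i) (D h hs).
  have dk := diff_is_derive (delta_mx 0 i) (D k ks).
  have [_ E] := is_deriveD (is_derive_mul (is_derive_cst a (chart_map c p) (delta_mx 0 i)) dh) dk.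
  by move: E; rewrite mul0r add0r => E; rewrite -[RHS]E.
- rewrite /coord_vector !asboolT //; last exact: smooth_germM.
  have dh := diff_is_derive (delta_mx 0 i) (D h hs).
  have dk := diff_is_derive (delta_mx 0 i) (D k ks).
  have [_ E] := is_derive_mul dh dk.
  by move: E; rewrite /= chart_mapK // => E; rewrite -[RHS]E.
by rewrite /coord_vector asboolF.
Qed.

End Germs.

Section TangentMink.
Context {R : realType} {n m : nat} {M : oriented_manifold R n}.
Local Notation E := 'rV[R]_m.+2.
Implicit Types (p : M) (X Y : (M -> R) -> R) (F G : M -> E).

Definition smooth_vgerm (p : M) F := forall i, smooth_germ p (fun x => F x 0 i).

Lemma tangent_mink p X F G : tangent p X -> smooth_vgerm p F -> smooth_vgerm p G ->
  X (fun x => mink (F x) (G x)) = mink (dvec F X) (G p) + mink (F p) (dvec G X).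
Proof.
move=> Xt Fs Gs.
have FG i : smooth_germ p (fun x => F x 0 i * G x 0 i) by exact: smooth_germM.
rewrite /mink (tangentD (k := fun x => - (F x 0 ord_max * G x 0 ord_max)) Xt).
- rewrite (tangent_sum _ Xt) // (tangentN Xt) // addrACA -opprD -big_split /=.
  rewrite (tangentM Xt) // !mxE; congr (_ - _).
  by apply: eq_bigr => i _; rewrite (tangentM Xt) // !mxE.
- by apply: smooth_germ_sum.
have := smooth_germ_linear (-1) (FG ord_max) (smooth_germ_cst p 0).
rewrite (_ : (fun x => _) = (fun x => - (F x 0 ord_max * G x 0 ord_max))) //.
by apply/funext => x; rewrite mulN1r addr0.
Qed.

Lemma dvec_lin F a X Y : dvec F (fun h => a * X h + Y h) = a *: dvec F X + dvec F Y.
Proof. by apply/rowP => i; rewrite !mxE. Qed.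

Lemma dvec_sum F (I : finType) (a : I -> R) (X : I -> (M -> R) -> R) :
  dvec F (fun h => \sum_i a i * X i h) = \sum_i a i *: dvec F (X i).
Proof. by apply/rowP => i; rewrite !mxE summxE; apply: eq_bigr => k _; rewrite !mxE. Qed.

End TangentMink.

(** * Lorentzian frames *)

Section LorentzFrame.
Context {R : realType} {n : nat}.
Local Notation E := 'rV[R]_n.+2.

Lemma sum_lift_max (V : nmodType) m (G : 'I_m.+1 -> V) :
  \sum_(i < m.+1) G i = \sum_(i < m) G (lift ord_max i) + G ord_max.
Proof.
rewrite big_ord_recr /=; congr (_ + _); apply: eq_bigr => i _; congr G.
by apply: val_inj; rewrite /= /bump leqNgt ltn_ord.
Qed.

(** Turns the Minkowski product into the standard one: the signature is absorbed
    in a change of sign of the last coordinate. *)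
Definition mink_dual (v : E) : E := \row_k (if k == ord_max then - v 0 k else v 0 k).

Lemma mink_dualE (x v : E) : mink x v = \sum_k x 0 k * mink_dual v 0 k.
Proof.
rewrite sum_lift_max mxE eqxx mulrN /mink; congr (_ - _).
apply: eq_bigr => i _; rewrite mxE.
by rewrite (negbTE (_ : lift ord_max i != ord_max)) // eq_sym neq_lift.
Qed.

Lemma mink_dualK (v : E) : mink_dual (mink_dual v) = v.
Proof. by apply/rowP => k; rewrite !mxE; case: eqP => // _; rewrite opprK. Qed.

Lemma mink_dualZ a (v : E) : mink_dual (a *: v) = a *: mink_dual v.
Proof. by apply/rowP => k; rewrite !mxE; case: eqP => // _; rewrite mulrN. Qed.

Lemma mink_dual_dual (x v : E) : mink (mink_dual x) (mink_dual v) = mink x v.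
Proof.
rewrite mink_dualE mink_dualK minkC mink_dualE.
by apply: eq_bigr => k _; rewrite mulrC.
Qed.

(** The matrix whose determinant defines the orientation; its rows are the tangent
    vectors [b], then the normal [v], then the point [x] of the hyperboloid. *)
Definition frame_mx (b : 'I_n -> E) (v x : E) : 'M[R]_n.+2 :=
  \matrix_(i < n.+2) oapp (fun j => oapp b v (unlift ord_max j)) x (unlift ord_max i).

Definition normal_row : 'I_n.+2 := lift ord_max ord_max.

Lemma row_frame_last b v x : row ord_max (frame_mx b v x) = x.
Proof. by rewrite rowK unlift_none. Qed.

Lemma row_frame_normal b v x : row normal_row (frame_mx b v x) = v.
Proof. by rewrite rowK liftK /= unlift_none. Qed.

Lemma row_frame b v x i : row (lift ord_max (lift ord_max i)) (frame_mx b v x) = b i.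
Proof. by rewrite rowK liftK /= liftK. Qed.

Variant frame_row_spec : 'I_n.+2 -> Type :=
  | FrameLast : frame_row_spec ord_max
  | FrameNormal : frame_row_spec normal_row
  | FrameTangent i : frame_row_spec (lift ord_max (lift ord_max i)).

Lemma frame_rowP i : frame_row_spec i.
Proof.
case: (unliftP ord_max i) => [j ->|->]; last exact: FrameLast.
by case: (unliftP ord_max j) => [k ->|->]; [exact: FrameTangent|exact: FrameNormal].
Qed.

Section Orthogonal.
Variables (b : 'I_n -> E) (v x : E).
Hypothesis det_gt0 : 0 < \det (frame_mx b v x).

Let F := frame_mx b v x.

Let Funit : F \in unitmx.
Proof. by rewrite unitmxE unitfE gt_eqF. Qed.

Lemma frame_mink i z : (F *m (mink_dual z)^T) i 0 = mink (row i F) z.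
Proof.
by rewrite mink_dualE mxE; apply: eq_bigr => k _; rewrite !mxE.
Qed.

(** The dual of [z] is in the kernel of an invertible matrix. *)
Lemma frame_orthogonal_eq0 z : mink x z = 0 -> mink v z = 0 ->
  (forall i, mink (b i) z = 0) -> z = 0.
Proof.
move=> xz vz bz.
have Fz : F *m (mink_dual z)^T = 0.
  apply/colP => i; rewrite frame_mink [RHS]mxE.
  by case: (frame_rowP i) => [||j]; rewrite ?row_frame_last ?row_frame_normal ?row_frame.
have : (mink_dual z)^T = 0 by rewrite -[LHS](mulKmx Funit) Fz mulmx0.
move/(congr1 trmx); rewrite trmxK trmx0 => dz.
by rewrite -[z]mink_dualK dz; apply/rowP => k; rewrite !mxE oppr0 if_same.
Qed.

Lemma frame_free (a : 'I_n -> R) : \sum_i a i *: b i = 0 -> forall i, a i = 0.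
Proof.
move=> ab i.
pose u : E := \row_k oapp (fun j => oapp a 0 (unlift ord_max j)) 0 (unlift ord_max k).
have um : u 0 ord_max = 0 by rewrite mxE unlift_none.
have un : u 0 normal_row = 0 by rewrite mxE liftK /= unlift_none.
have ua j : u 0 (lift ord_max (lift ord_max j)) = a j by rewrite mxE liftK /= liftK.
have uF : u *m F = 0.
  rewrite mulmx_sum_row !sum_lift_max -/normal_row um un !scale0r !addr0 -[RHS]ab.
  by apply: eq_bigr => j _; rewrite row_frame ua.
have u0 : u = 0 by rewrite -[u](mulmxK Funit) uF mul0mx.
by rewrite -ua u0 mxE.
Qed.

Hypothesis xx : mink x x = -1.
Hypothesis vv : mink v v = 1.
Hypothesis xv : mink x v = 0.
Hypothesis xb : forall i, mink x (b i) = 0.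
Hypothesis vb : forall i, mink v (b i) = 0.

(** The coordinates of [z] along [v] and [x] are, up to sign, its products with
    [v] and [x], as these are unit vectors orthogonal to the rest of the frame. *)
Lemma frame_span z : mink x z = 0 -> mink v z = 0 -> exists a, z = \sum_i a i *: b i.
Proof.
move=> xz vz; pose u := z *m invmx F.
have uF : z = u *m F by rewrite /u mulmxKV.
pose a i := u 0 (lift ord_max (lift ord_max i)); exists a.
have ez : z = \sum_i a i *: b i + u 0 normal_row *: v + u 0 ord_max *: x.
  rewrite {1}uF mulmx_sum_row !sum_lift_max -/normal_row row_frame_last row_frame_normal.
  by congr (_ + _ + _); apply: eq_bigr => j _; rewrite row_frame.
have sb w : (forall i, mink w (b i) = 0) -> mink w (\sum_i a i *: b i) = 0.
  move=> wb; rewrite minkC mink_suml big1 // => i _.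
  by rewrite minkZl minkC wb mulr0.
have un : u 0 normal_row = 0.
  by have := vz; rewrite ez !minkDr sb // !minkZr vv (minkC v) xv mulr0 addr0 add0r mulr1.
have um : u 0 ord_max = 0.
  have := xz; rewrite ez !minkDr sb // !minkZr xx xv mulr0 !add0r mulrN1.
  by move/eqP; rewrite oppr_eq0 => /eqP.
by rewrite {1}ez un um !scale0r !addr0.
Qed.

Definition normal_cofactor : E := \row_k cofactor F normal_row k.

(** By Cramer's rule the frame matrix sends the vector of cofactors to [\det F]
    times a basis vector, and by orthonormality it sends the dual of [v] to that
    basis vector. *)
Lemma normal_cofactorE : normal_cofactor = \det F *: mink_dual v.
Proof.
set C := normal_cofactor.
have FC : F *m C^T = F *m (\det F *: (mink_dual v)^T).
  apply/colP => i; rewrite -scalemxAr [RHS]mxE frame_mink.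
  have -> : (F *m C^T) i 0 = (F *m \adj F) i normal_row.
    by rewrite !mxE; apply: eq_bigr => k _; rewrite !mxE.
  rewrite mul_mx_adj !mxE.
  case: (frame_rowP i) => [||j].
  - by rewrite row_frame_last xv mulr0 (negbTE (neq_lift _ _)).
  - by rewrite row_frame_normal vv mulr1 eqxx.
  rewrite row_frame minkC vb mulr0 (inj_eq lift_inj) eq_sym.
  by rewrite (negbTE (neq_lift _ _)).
apply: trmx_inj; rewrite linearZ /=.
by rewrite -[LHS](mulKmx Funit) FC mulKmx.
Qed.

Lemma mink_normal_cofactor : mink normal_cofactor normal_cofactor = \det F * \det F.
Proof. by rewrite normal_cofactorE !minkE mink_dual_dual vv mulr1. Qed.

(** The right-hand side does not involve [v], since the cofactors along the row of
    [v] do not; this is what makes the unit normal smooth.  The positive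
    orientation selects the sign. *)
Lemma unit_normal_cofactor :
  v = rsqrt (mink normal_cofactor normal_cofactor) *: mink_dual normal_cofactor.
Proof.
rewrite mink_normal_cofactor normal_cofactorE mink_dualZ mink_dualK scalerA.
have -> : rsqrt (\det F * \det F) * \det F = 1.
  by rewrite /rsqrt -expr2 sqrtr_sqr gtr0_norm // mulVf // gt_eqF.
by rewrite scale1r.
Qed.

End Orthogonal.

Lemma Ck_det (V : normedModType R) k (U : set V) m (A : V -> 'M[R]_m) : open U ->
  (forall i j, Ck k U (fun y => A y i j)) -> Ck k U (fun y => \det (A y)).
Proof.
move=> oU HA; rewrite /determinant; apply: Ck_sum => // s; apply: CkM => //.
  exact: Ck_cst.
by apply: Ck_prod => // i _; exact: HA.
Qed.

(** The minors omit the row of [v], so the cofactors are polynomials in the other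
    rows alone. *)
Lemma Ck_cofactor_frame (V : normedModType R) k (U : set V) 
    (b : 'I_n -> V -> E) (v x : V -> E) l : open U ->
  (forall i j, Ck k U (fun y => b i y 0 j)) -> (forall j, Ck k U (fun y => x y 0 j)) ->
  Ck k U (fun y => cofactor (frame_mx (b^~ y) (v y) (x y)) normal_row l).
Proof.
move=> oU Hb Hx; rewrite /cofactor; apply: CkM => //; first exact: Ck_cst.
apply: Ck_det => // i j.
have H y : row' normal_row (col' l (frame_mx (b^~ y) (v y) (x y))) i j =
   oapp (fun j => oapp (b^~ y) (v y) (unlift ord_max j)) (x y)
     (unlift ord_max (lift normal_row i)) 0 (lift l j).
  by rewrite !mxE.
apply: Ck_eq oU _ (_ : Ck k U (fun y => oapp (fun j => oapp (b^~ y) (v y) (unlift ord_max j)) (x y)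
   (unlift ord_max (lift normal_row i)) 0 (lift l j))) => [y _|]; first by rewrite H.
have := neq_lift normal_row i.
case: (frame_rowP (lift normal_row i)) => [_||h _]; rewrite ?unlift_none ?eqxx //.
by rewrite liftK /= liftK /=.
Qed.

End LorentzFrame.

(** * Families of maps in a chart *)

Section FamilyInChart.
Context {R : realType} {n : nat} {M : oriented_manifold R n}.
Variables (eps : R) (c : chart R n M).
Hypothesis ac : atlas c.

Definition chart_time : set ('rV[R]_n * R) :=
  [set ut | chart_range c ut.1 /\ - eps < ut.2 < eps].

Definition in_chart (W : Type) (F : M -> R -> W) (ut : 'rV[R]_n * R) : W :=
  F (chart_inv c ut.1) ut.2.

Definition space_dir (i : 'I_n) : 'rV[R]_n * R := (delta_mx 0 i, 0).
Definition time_dir : 'rV[R]_n * R := (0, 1).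

Lemma chart_time_open : open chart_time.
Proof.
have -> : chart_time = (setT `&` fst @^-1` chart_range c) `&`
    (setT `&` snd @^-1` `]- eps, eps[%classic).
  by apply/seteqP; split=> [[u t] [/= H1 H2]|[u t] [[_ /= H1] [_ /= H2]]];
    [do !split=> //=; rewrite in_itv|split=> //=; rewrite in_itv in H2].
apply: openI.
  apply: continuous_on_preimage; [exact: openT| |exact: chart_range_open].
  by move=> y _; exact: cvg_fst.
apply: continuous_on_preimage; [exact: openT| |exact: interval_open].
by move=> y _; exact: cvg_snd.
Qed.

Lemma chart_time_map p t : chart_dom c p -> - eps < t < eps ->
  chart_time (chart_map c p, t).
Proof. by move=> cp te; split=> //; exact: chart_range_map. Qed.

Lemma Ck_in_chart (W : normedModType R) (F : M -> R -> W) k :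
  smooth_family eps F -> Ck k chart_time (in_chart F).
Proof. by move=> Fs; exact: Fs. Qed.

Lemma Ck_slice (F : M -> R -> R) k t :
  - eps < t < eps -> smooth_family eps F ->
  Ck k (chart_range c) (fun u => F (chart_inv c u) t).
Proof.
move=> te Fs; have oc := chart_range_open ac.
apply: (@Ck_comp _ _ _ k (chart_range c) chart_time (fun u => (u, t)) (in_chart F)) => //.
- by apply: finite_dim_pair; [exact: finite_dim_rV|exact: finite_dim_R].
- by apply: Ck_pair => //; [exact: Ck_id|exact: Ck_cst].
exact: Ck_in_chart.
Qed.

Lemma slice_space (W : normedModType R) (f : 'rV[R]_n * R -> W) u t v :
  differentiable f (u, t) -> 'D_v (fun u => f (u, t)) u = 'D_(v, 0) f (u, t).
Proof.
move=> df.
have dp : is_derive u v (fun u : 'rV[R]_n => (u, t)) (v, 0).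
  exact: (is_derive_pair (is_derive_id u v) (is_derive_cst t u v)).
have dd : differentiable (fun u : 'rV[R]_n => (u, t)) u.
  by apply: differentiable_pair; [exact: ex_diff|exact: differentiable_cst].
have [_ E] := is_derive_comp v dd df.
by rewrite E; case: dp => _ ->.
Qed.

Lemma slice_time (W : normedModType R) (f : 'rV[R]_n * R -> W) u t :
  differentiable f (u, t) -> is_derive t 1 (fun s => f (u, s)) ('D_time_dir f (u, t)).
Proof.
exact: (is_derive_comp1 (is_derive_pair (is_derive_cst u t 1) (is_derive_id t 1))).
Qed.

Lemma in_chart_differentiable (W : normedModType R) (F : M -> R -> W) u t :
  smooth_family eps F -> chart_time (u, t) -> differentiable (in_chart F) (u, t).
Proof. by move=> Fs ut; have [H _] := Ck_in_chart 1 Fs; exact: H. Qed.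

Lemma family_germ (F : M -> R -> R) p t : smooth_family eps F -> chart_dom c p ->
  - eps < t < eps -> smooth_germ p (F^~ t).
Proof.
move=> Fs cp te; exists c => //; split=> //; exists (chart_range c).
split; [exact: chart_range_open|exact: chart_range_map|].
by move=> k; exact: Ck_slice.
Qed.

Lemma family_coord_vector (F : M -> R -> R) p t i : smooth_family eps F ->
  chart_dom c p -> - eps < t < eps ->
  coord_vector c p i (F^~ t) = 'D_(space_dir i) (in_chart F) (chart_map c p, t).
Proof.
move=> Fs cp te; rewrite /coord_vector asboolT; last exact: family_germ.
rewrite -slice_space //; apply: in_chart_differentiable => //.
exact: chart_time_map.
Qed.

End FamilyInChart.

Arguments chart_time_open {R n M} eps {c} ac.

Section Families.
Context {R : realType} {n : nat} {M : oriented_manifold R n}.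
Variables (eps : R).

Lemma smooth_family_entry m (F : M -> R -> 'rV[R]_m) k :
  smooth_family eps F -> smooth_family eps (fun p t => F p t 0 k).
Proof.
move=> Fs c ac l; apply: Ck_entry; last exact: Fs.
exact: chart_time_open.
Qed.

Lemma family_slice_smooth m (F : M -> R -> 'rV[R]_m) c t : smooth_family eps F ->
  - eps < t < eps -> atlas c -> smooth_on (chart_range c) (F^~ t \o chart_inv c).
Proof.
move=> Fs te ac k; apply: (Ck_coordinates (chart_range_open ac) (@coordinates_rV R m)) => l.
exact: (Ck_slice ac k te (smooth_family_entry l Fs)).
Qed.

Lemma family_dvec m (F : M -> R -> 'rV[R]_m) c p t i : smooth_family eps F ->
  atlas c -> chart_dom c p -> - eps < t < eps ->
  dvec (F^~ t) (coord_vector c p i) = 'D_(space_dir i) (in_chart c F) (chart_map c p, t).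
Proof.
move=> Fs ac cp te; apply/rowP => k; rewrite mxE.
rewrite (@family_coord_vector _ _ _ eps c ac (fun p t => F p t 0 k)) //; last first.
  exact: smooth_family_entry.
have dF := in_chart_differentiable ac Fs (chart_time_map cp te).
have /is_derive_rVP /(_ k) [_ <-] := diff_is_derive (space_dir i) dF.
by [].
Qed.

Lemma family_time_derive (W : normedModType R) (F : M -> R -> W) c p t : smooth_family eps F ->
  atlas c -> chart_dom c p -> - eps < t < eps ->
  is_derive t 1 (F p) ('D_time_dir (in_chart c F) (chart_map c p, t)).
Proof.
move=> Fs ac cp te.
have dF := in_chart_differentiable ac Fs (chart_time_map cp te).
by have := slice_time dF; rewrite /in_chart /= chart_mapK.
Qed.

End Families.

Section VectorSecondDerivatives.
Context {R : realType} {V : normedModType R} {m : nat}.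

Lemma derive_comm_rV (U : set V) (F : V -> 'rV[R]_m) (x v w : V) :
  open U -> U x -> Ck 2 U F -> 'D_w ('D_v F) x = 'D_v ('D_w F) x.
Proof.
move=> oU Ux HF; have [F1 F2] := HF.
have E u z k : ('D_z ('D_u F) x) 0 k = 'D_z ('D_u (fun y => F y 0 k)) x.
  have /is_derive_rVP /(_ k) [_ <-] := diff_is_derive z ((F2 u).1 x Ux).
  apply: near_eq_derive; apply: filterS (open_near oU Ux) => y Uy.
  by have /is_derive_rVP /(_ k) [_ <-] := diff_is_derive u (F1 y Uy).
apply/rowP => k; have Ek := derive_comm v w oU Ux (Ck_entry k oU HF).
exact: (etrans (E v w k) (etrans Ek (esym (E w v k)))).
Qed.

End VectorSecondDerivatives.

Section MinkConstant.
Context {R : realType} {V : normedModType R} {n : nat}.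
Local Notation E := 'rV[R]_n.+2.

Lemma mink_const_derive (U : set V) (F G : V -> E) (a : R) (y v : V) :
  open U -> U y -> differentiable F y -> differentiable G y ->
  (forall z, U z -> mink (F z) (G z) = a) ->
  mink ('D_v F y) (G y) + mink (F y) ('D_v G y) = 0.
Proof.
move=> oU Uy dF dG FG.
have [_ <-] := is_derive_mink (diff_is_derive v dF) (diff_is_derive v dG).
transitivity ('D_v (cst a) y : R); last exact: derive_cst.
by apply: near_eq_derive; apply: filterS (open_near oU Uy) => z; exact: FG.
Qed.

End MinkConstant.

(** * Evolution of the unit normal *)

Section Evolution.
Context {R : realType} {n : nat} {M : oriented_manifold R n}.
Local Notation E := 'rV[R]_n.+2.
Variables (eps : R) (sigma nu : M -> R -> E).
Hypothesis sigma_smooth : smooth_family eps sigma.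
Hypothesis nu_normal : forall t : R, - eps < t < eps -> unit_normal (sigma^~ t) (nu^~ t).

Lemma chart_frame c p t : atlas c -> chart_dom c p -> - eps < t < eps ->
  [/\ mink (sigma p t) (nu p t) = 0, mink (nu p t) (nu p t) = 1,
     forall i, mink (nu p t) ('D_(space_dir i) (in_chart c sigma) (chart_map c p, t)) = 0 &
     0 < \det (frame_mx (fun i => 'D_(space_dir i) (in_chart c sigma) (chart_map c p, t))
           (nu p t) (sigma p t))].
Proof.
move=> ac cp te; have [sn nn nt fr] := nu_normal te p; split=> //.
  move=> i; rewrite -(family_dvec i sigma_smooth) //; apply: nt.
  exact: coord_vector_tangent.
have := fr c ac cp; rewrite /positive_frame /frame_mx.
have -> : (fun i => dvec (sigma^~ t) (coord_vector c p i)) =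
   (fun i => 'D_(space_dir i) (in_chart c sigma) (chart_map c p, t)); last by [].
by apply/funext => i; exact: (family_dvec i sigma_smooth).
Qed.

(** In a chart, the rows of the frame other than the normal are sigma and its
    first derivatives; [unit_normal_cofactor] then expresses nu by them. *)
Lemma unit_normal_smooth : smooth_family eps nu.
Proof.
move=> c ac k; have oW := chart_time_open eps ac.
have HS j l : Ck j (chart_time eps c) (fun ut => in_chart c sigma ut 0 l).
  by apply: Ck_entry => //; exact: sigma_smooth.
have HD i j l : Ck j (chart_time eps c) (fun ut => 'D_(space_dir i) (in_chart c sigma) ut 0 l).
  apply: Ck_entry => //.
  have [_ H] : Ck j.+1 (chart_time eps c) (in_chart c sigma) by exact: sigma_smooth.
  exact: H.
pose C ut := normal_cofactor (fun i => 'D_(space_dir i) (in_chart c sigma) ut)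
  (in_chart c nu ut) (in_chart c sigma ut).
have HC j l : Ck j (chart_time eps c) (fun ut => C ut 0 l).
  apply: (@Ck_eq _ _ _ _ _ (fun ut => cofactor
    (frame_mx (fun i => 'D_(space_dir i) (in_chart c sigma) ut)
      (in_chart c nu ut) (in_chart c sigma ut)) normal_row l)) => //.
    by move=> ut _; rewrite mxE.
  exact: Ck_cofactor_frame.
have chart_pt ut : chart_time eps c ut -> exists2 p, chart_dom c p &
    [/\ ut = (chart_map c p, ut.2), chart_inv c ut.1 = p & - eps < ut.2 < eps].
  case: ut => u t [/= [p cp <-] te]; exists p => //; split=> //; exact: chart_mapK.
have CC ut : chart_time eps c ut -> 0 < mink (C ut) (C ut) /\
   in_chart c nu ut = rsqrt (mink (C ut) (C ut)) *: mink_dual (C ut).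
  move=> /chart_pt[p cp [ute up te]].
  have [sn nn nt fr] := chart_frame ac cp te.
  have eS : in_chart c sigma ut = sigma p ut.2 by rewrite /in_chart up.
  have eN : in_chart c nu ut = nu p ut.2 by rewrite /in_chart up.
  rewrite -eS -eN -ute in sn nn nt fr.
  split; last exact: (unit_normal_cofactor fr nn sn nt).
  by rewrite (mink_normal_cofactor fr nn sn nt) mulr_gt0.
apply: (Ck_coordinates oW (@coordinates_rV R n.+2)) => l.
have Hd : Ck k (chart_time eps c) (fun ut => mink_dual (C ut) 0 l).
  case: (eqVneq l ord_max) => [->|lm].
    have H := CkM oW (Ck_cst k _ (-1 : R)) (HC k ord_max).
    by apply: Ck_eq H => // ut _; rewrite [RHS]mxE eqxx mulN1r.
  by apply: Ck_eq (HC k l) => // ut _; rewrite [RHS]mxE (negbTE lm).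
have Hr : Ck k (chart_time eps c) (fun ut => rsqrt (mink (C ut) (C ut))).
  by apply: Ck_rsqrt => //; [move=> ut /CC []|exact: Ck_mink].
apply: Ck_eq (CkM oW Hr Hd) => // ut /CC [_ e].
by rewrite -[nu _ _]/(in_chart c nu ut) e [RHS]mxE.
Qed.

Lemma chart_differentiable (F : M -> R -> E) c p t :
  smooth_family eps F -> atlas c -> chart_dom c p ->
  - eps < t < eps -> differentiable (in_chart c F) (chart_map c p, t).
Proof. by move=> Fs ac cp te; apply: in_chart_differentiable Fs _ => //; exact: chart_time_map. Qed.

Lemma chart_differentiable2 (F : M -> R -> E) c p t v :
  smooth_family eps F -> atlas c -> chart_dom c p ->
  - eps < t < eps -> differentiable ('D_v (in_chart c F)) (chart_map c p, t).
Proof.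
move=> Fs ac cp te; have [_ H] := Ck_in_chart ac 2 Fs.
by have [H1 _] := H v; apply: H1; exact: chart_time_map.
Qed.

Lemma normal_conormal c j z : atlas c -> chart_time eps c z ->
  mink (in_chart c nu z) ('D_(space_dir j) (in_chart c sigma) z) = 0.
Proof.
case: z => u t ac [/= [p cp <-] te].
by have [_ _ H _] := chart_frame ac cp te; rewrite /in_chart /= chart_mapK.
Qed.

(** The derivative of <nu, d_i sigma> = 0 along [v]. *)
Lemma second_form_chart c p t i v : atlas c -> chart_dom c p -> - eps < t < eps ->
  mink ('D_v (in_chart c nu) (chart_map c p, t))
       ('D_(space_dir i) (in_chart c sigma) (chart_map c p, t)) =
  - mink (nu p t) ('D_v ('D_(space_dir i) (in_chart c sigma)) (chart_map c p, t)).
Proof.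
move=> ac cp te; apply/eqP; rewrite -addr_eq0; apply/eqP.
have := mink_const_derive v (chart_time_open eps ac) (chart_time_map cp te)
  (chart_differentiable unit_normal_smooth ac cp te)
  (chart_differentiable2 (space_dir i) sigma_smooth ac cp te)
  (fun z zt => normal_conormal i ac zt).
by rewrite [in_chart c nu (_, _)]/in_chart /= chart_mapK.
Qed.

(** Both sides are minus the product of nu with a second derivative of sigma,
    which is symmetric. *)
Lemma second_form_sym c p t i j : atlas c -> chart_dom c p -> - eps < t < eps ->
  mink (dvec (nu^~ t) (coord_vector c p i)) (dvec (sigma^~ t) (coord_vector c p j)) =
  mink (dvec (nu^~ t) (coord_vector c p j)) (dvec (sigma^~ t) (coord_vector c p i)).
Proof.
move=> ac cp te.
have dn k := family_dvec k unit_normal_smooth ac cp te.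
have ds k := family_dvec k sigma_smooth ac cp te.
rewrite (dn i) (dn j) (ds i) (ds j).
have sf k l := second_form_chart k (space_dir l) ac cp te.
have dc := derive_comm_rV (space_dir i) (space_dir j) (chart_time_open eps ac)
  (chart_time_map cp te) (Ck_in_chart ac 2 sigma_smooth).
exact: (etrans (sf j i) (etrans (congr1 (fun z => - mink (nu p t) z) (esym dc)) (esym (sf i j)))).
Qed.

Variable f : M -> R -> R.
Hypothesis f_smooth : smooth_family eps f.
Hypothesis sigma_evol : forall (p : M) (t : R), - eps < t < eps ->
  is_derive t 1 (sigma p) (f p t *: nu p t).

Lemma chart_evolution c z : atlas c -> chart_time eps c z ->
  'D_time_dir (in_chart c sigma) z = in_chart c f z *: in_chart c nu z.
Proof.
case: z => u t ac [/= [p cp <-] te].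
have [_ <-] := family_time_derive sigma_smooth ac cp te.
by rewrite /in_chart /= chart_mapK //; have [_ ->] := sigma_evol p te.
Qed.

(** The three products come from differentiating in time <sigma, nu> = 0,
    <nu, nu> = 1 and <nu, d_i sigma> = 0; in the last one, the time derivative of
    d_i sigma is d_i (f nu) because second derivatives commute. *)
Lemma normal_evolution c p t : atlas c -> chart_dom c p -> - eps < t < eps ->
  exists d, [/\ is_derive t 1 (nu p) d, mink (sigma p t) d = - f p t, mink (nu p t) d = 0 &
    forall i, mink (dvec (sigma^~ t) (coord_vector c p i)) d = - coord_vector c p i (f^~ t)].
Proof.
move=> ac cp te; exists ('D_time_dir (in_chart c nu) (chart_map c p, t)).
have oW := chart_time_open eps ac; have zt := chart_time_map cp te.
have eN : in_chart c nu (chart_map c p, t) = nu p t by rewrite /in_chart /= chart_mapK.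
have eS : in_chart c sigma (chart_map c p, t) = sigma p t by rewrite /in_chart /= chart_mapK.
have ef : in_chart c f (chart_map c p, t) = f p t by rewrite /in_chart /= chart_mapK.
have dN := chart_differentiable unit_normal_smooth ac cp te.
have dS := chart_differentiable sigma_smooth ac cp te.
have df : differentiable (in_chart c f) (chart_map c p, t).
  exact: in_chart_differentiable f_smooth zt.
have NN z : chart_time eps c z -> mink (in_chart c nu z) (in_chart c nu z) = 1.
  by case: z => u s [/= _ se]; have [] := nu_normal se (chart_inv c u).
have SN z : chart_time eps c z -> mink (in_chart c sigma z) (in_chart c nu z) = 0.
  by case: z => u s [/= _ se]; have [] := nu_normal se (chart_inv c u).
have N0 v : mink (nu p t) ('D_v (in_chart c nu) (chart_map c p, t)) = 0.
  have := mink_const_derive v oW zt dN dN NN.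
  by rewrite minkC -mulr2n eN => /eqP; rewrite mulrn_eq0 /= => /eqP.
split.
- exact: (family_time_derive unit_normal_smooth ac cp te).
- have := mink_const_derive time_dir oW zt dS dN SN.
  rewrite (chart_evolution ac zt) eS eN ef minkZl.
  have [_ -> _ _] := chart_frame ac cp te.
  by rewrite mulr1 addrC => /eqP; rewrite addr_eq0 => /eqP.
- exact: N0.
move=> i; rewrite minkC (family_dvec i sigma_smooth ac cp te) (second_form_chart i _ ac cp te).
rewrite (derive_comm_rV _ _ oW zt (Ck_in_chart ac 2 sigma_smooth)).
have -> : 'D_(space_dir i) ('D_time_dir (in_chart c sigma)) (chart_map c p, t) =
    'D_(space_dir i) (in_chart c f) (chart_map c p, t) *: nu p t
    + f p t *: 'D_(space_dir i) (in_chart c nu) (chart_map c p, t).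
  rewrite -eN -ef.
  have [_ <-] := is_derive_scaler (diff_is_derive (space_dir i) df)
    (diff_is_derive (space_dir i) dN).
  by apply: near_eq_derive; apply: filterS (open_near oW zt) => z; exact: chart_evolution.
rewrite minkDr !minkZr N0 mulr0 addr0.
have [_ -> _ _] := chart_frame ac cp te.
by rewrite mulr1 (family_coord_vector ac i f_smooth).
Qed.

End Evolution.

(** * Geometry of one hypersurface *)

Section HypersurfaceGeometry.
Context {R : realType} {n : nat} {M : oriented_manifold R n}.
Local Notation E := 'rV[R]_n.+2.
Implicit Types (c : chart R n M) (p : M) (X Y : (M -> R) -> R).
Variables s nu : M -> E.
Hypothesis s_smooth : forall c, atlas c -> smooth_on (chart_range c) (s \o chart_inv c).
Hypothesis nu_smooth : forall c, atlas c -> smooth_on (chart_range c) (nu \o chart_inv c).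
Hypothesis s_hyp : forall p, hyperboloid (s p).
Hypothesis s_imm : immersion s.
Hypothesis s_nu : unit_normal s nu.

Lemma map_vgerm (F : M -> E) p :
  (forall c, atlas c -> smooth_on (chart_range c) (F \o chart_inv c)) -> smooth_vgerm p F.
Proof.
move=> Fs i; have [c ac cp] := atlas_cover p; exists c => //; split=> //.
exists (chart_range c); split; [exact: chart_range_open|exact: chart_range_map|].
move=> k; exact: (Ck_entry i (chart_range_open ac) (Fs c ac k)).
Qed.

Let sg p : smooth_vgerm p s := map_vgerm p s_smooth.
Let ng p : smooth_vgerm p nu := map_vgerm p nu_smooth.

Lemma mink_ss p : mink (s p) (s p) = -1. Proof. by have [] := s_hyp p. Qed.
Lemma mink_sn p : mink (s p) (nu p) = 0. Proof. by have [] := s_nu p. Qed.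
Lemma mink_nn p : mink (nu p) (nu p) = 1. Proof. by have [] := s_nu p. Qed.

Lemma mink_n_ds p X : tangent p X -> mink (nu p) (dvec s X) = 0.
Proof. by have [_ _ H _] := s_nu p; exact: H. Qed.

Lemma tangent_mink_const p X (F G : M -> E) a : tangent p X ->
  smooth_vgerm p F -> smooth_vgerm p G -> (forall x, mink (F x) (G x) = a) ->
  mink (dvec F X) (G p) + mink (F p) (dvec G X) = 0.
Proof.
move=> Xt Fs Gs FG; rewrite -(tangent_mink Xt Fs Gs) -[RHS](tangent_cst a Xt).
by congr X; apply/funext.
Qed.

Lemma mink_sym_eq0 (x y : E) : mink y x + mink x y = 0 -> mink x y = 0.
Proof. by rewrite minkC -mulr2n => /eqP; rewrite mulrn_eq0 /= => /eqP. Qed.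

Lemma mink_s_ds p X : tangent p X -> mink (s p) (dvec s X) = 0.
Proof.
by move=> Xt; apply: mink_sym_eq0; exact: tangent_mink_const Xt (sg p) (sg p) mink_ss.
Qed.

Lemma mink_n_dn p X : tangent p X -> mink (nu p) (dvec nu X) = 0.
Proof.
by move=> Xt; apply: mink_sym_eq0; exact: tangent_mink_const Xt (ng p) (ng p) mink_nn.
Qed.

Lemma mink_s_dn p X : tangent p X -> mink (s p) (dvec nu X) = 0.
Proof.
move=> Xt; have := tangent_mink_const Xt (sg p) (ng p) mink_sn.
by rewrite minkC mink_n_ds // add0r.
Qed.

Lemma lift_T1H p : T1H (lift_map s nu p).
Proof. by split=> /=; [exact: s_hyp|exact: mink_sn|exact: mink_nn]. Qed.

Lemma dlift_chi_perp p X : tangent p X -> chi_perp (lift_map s nu p) (dlift s nu X).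
Proof.
move=> Xt; apply/chi_perpP; rewrite /horizontal_vector /=.
by rewrite ![mink _ (nu p)]minkC mink_s_ds // mink_n_ds // mink_s_dn // mink_n_dn.
Qed.

Section AtChart.
Variables (c : chart R n M) (p : M).
Hypotheses (ac : atlas c) (cp : chart_dom c p).

Let ct i : tangent p (coord_vector c p i) := coord_vector_tangent i ac cp.

Lemma frame_det : 0 < \det (frame_mx (fun i => dvec s (coord_vector c p i)) (nu p) (s p)).
Proof. by have [_ _ _ H] := s_nu p; exact: H c ac cp. Qed.

Lemma frame_eq0 z : mink (s p) z = 0 -> mink (nu p) z = 0 ->
  (forall i, mink (dvec s (coord_vector c p i)) z = 0) -> z = 0.
Proof. exact: (frame_orthogonal_eq0 frame_det). Qed.

Lemma tangent_span_vector z : mink (s p) z = 0 -> mink (nu p) z = 0 ->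
  exists a : 'I_n -> R, z = dvec s (fun h => \sum_i a i * coord_vector c p i h).
Proof.
move=> sz nz.
have [a ->] := frame_span frame_det (mink_ss p) (mink_nn p) (mink_sn p)
  (fun i => mink_s_ds (ct i)) (fun i => mink_n_ds (ct i)) sz nz.
by exists a; rewrite dvec_sum.
Qed.

Lemma dvec_s_inj X Y : tangent p X -> tangent p Y -> dvec s X = dvec s Y -> X = Y.
Proof.
move=> Xt Yt XY; have Zt := tangent_comb (-1) Xt Yt.
have := s_imm Zt; rewrite dvec_lin XY scaleN1r addNr => /(_ erefl) Z0.
apply/funext => h; have := congr1 (fun D => D h) Z0.
by rewrite /= mulN1r addrC => /subr0_eq.
Qed.

(** Both [X] and the combination of coordinate vectors supplied by
    [tangent_span_vector] have the same image under the injective map d sigma. *)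
Lemma tangent_span X : tangent p X ->
  exists a : 'I_n -> R, X = (fun h => \sum_i a i * coord_vector c p i h).
Proof.
move=> Xt; have [a E1] := tangent_span_vector (mink_s_ds Xt) (mink_n_ds Xt).
exists a; apply: dvec_s_inj => //; exact: tangent_lin.
Qed.

End AtChart.

(** d nu X is orthogonal to sigma and nu, so it is its own projection to the
    tangent space of the hyperboloid, and lies in the image of d sigma. *)
Lemma shape_operatorP p X : tangent p X ->
  tangent p (shape_operator s nu p X) /\ dvec s (shape_operator s nu p X) = - dvec nu X.
Proof.
move=> Xt; have [c ac cp] := atlas_cover p.
have LC : levi_civita s nu p X = dvec nu X.
  by rewrite /levi_civita /hyp_proj minkC mink_s_dn // scale0r addr0.
rewrite -LC; apply: (@xgetPex _ _ [set Y | tangent p Y /\ dvec s Y = - levi_civita s nu p X]).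
have sz : mink (s p) (- dvec nu X) = 0 by rewrite minkNr mink_s_dn // oppr0.
have nz : mink (nu p) (- dvec nu X) = 0 by rewrite minkNr mink_n_dn // oppr0.
have [a E1] := tangent_span_vector ac cp sz nz.
exists (fun h => \sum_i a i * coord_vector c p i h); rewrite LC; split=> //.
by apply: tangent_lin => i; exact: coord_vector_tangent.
Qed.

Hypothesis form_sym : forall c p i j, atlas c -> chart_dom c p ->
  mink (dvec nu (coord_vector c p i)) (dvec s (coord_vector c p j)) =
  mink (dvec nu (coord_vector c p j)) (dvec s (coord_vector c p i)).

Lemma second_form_symmetric p X Y : tangent p X -> tangent p Y ->
  mink (dvec nu X) (dvec s Y) = mink (dvec nu Y) (dvec s X).
Proof.
move=> Xt Yt; have [c ac cp] := atlas_cover p.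
have [a ->] := tangent_span ac cp Xt; have [b ->] := tangent_span ac cp Yt.
rewrite !dvec_sum !mink_suml.
have expand (u v : 'I_n -> R) (F G : 'I_n -> E) : \sum_i mink (u i *: F i) (\sum_j v j *: G j) =
    \sum_i \sum_j u i * v j * mink (F i) (G j).
  apply: eq_bigr => i _; rewrite minkZl minkC mink_suml mulr_sumr.
  by apply: eq_bigr => j _; rewrite minkZl mulrA minkC.
rewrite !expand exchange_big; apply: eq_bigr => i _; apply: eq_bigr => j _.
exact: (congr2 *%R (mulrC (a j) (b i)) (form_sym j i ac cp)).
Qed.

Definition first_minus_third X Y : R :=
  mink (dvec s X) (dvec s Y) - mink (dvec nu X) (dvec nu Y).

Hypothesis s_small : small_principal_curvatures s nu.

(** Degeneracy at [X] means B (B X) = X by self-adjointness.  Then X + B X is fixed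
    by B, so it vanishes since 1 is not an eigenvalue; hence B X = - X, and X
    vanishes since -1 is not an eigenvalue. *)
Lemma first_minus_third_nondegenerate p X : tangent p X ->
  (forall Y, tangent p Y -> first_minus_third X Y = 0) -> X = (fun=> 0).
Proof.
move=> Xt X0; have [c ac cp] := atlas_cover p.
pose B := shape_operator s nu p.
have [BXt BX] := shape_operatorP Xt; have [BBt BB] := shape_operatorP BXt.
have XBB : dvec s X = dvec s (B (B X)).
  apply/eqP; rewrite -subr_eq0; apply/eqP; apply: (frame_eq0 ac cp).
  - by rewrite minkBr !mink_s_ds // subrr.
  - by rewrite minkBr !mink_n_ds // subrr.
  move=> i; have it := coord_vector_tangent i ac cp.
  have [Bit Bi] := shape_operatorP it.
  rewrite minkC minkBl -[RHS](X0 _ it) /first_minus_third; congr (_ - _).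
  rewrite BB minkNl (second_form_symmetric BXt it) BX minkNr opprK.
  by rewrite minkC.
have XE : X = B (B X) := dvec_s_inj Xt BBt XBB.
(* The factor 1 puts the sum in the form of the linearity lemmas. *)
pose Z : (M -> R) -> R := fun h => 1 * X h + B X h.
have Zt : tangent p Z := tangent_comb 1 Xt BXt.
have BZ : B Z = Z.
  have [BZt EZ] := shape_operatorP Zt.
  apply: (dvec_s_inj BZt Zt); rewrite EZ /Z !dvec_lin !scale1r opprD -BX -BB.
  by rewrite -XBB addrC.
have Z0 : Z = (fun=> 0).
  apply: contrapT => Zn; have : B Z = (fun h => 1 * Z h).
    by rewrite BZ; apply/funext => h; rewrite mul1r.
  by move/(s_small Zt Zn) => /andP[_]; rewrite ltxx.
apply: contrapT => Xn; have : B X = (fun h => -1 * X h).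
  apply/funext => h; have := congr1 (fun D => D h) Z0.
  by rewrite /Z /= mul1r mulN1r addrC => /eqP; rewrite addr_eq0 => /eqP.
by move/(s_small Xt Xn) => /andP[]; rewrite ltxx.
Qed.

Lemma first_minus_thirdC X Y : first_minus_third X Y = first_minus_third Y X.
Proof. by rewrite /first_minus_third minkC [X in _ - X]minkC. Qed.

Lemma first_minus_third_suml (I : finType) (a : I -> R) (X : I -> (M -> R) -> R) Y :
  first_minus_third (fun h => \sum_i a i * X i h) Y = \sum_i a i * first_minus_third (X i) Y.
Proof.
rewrite /first_minus_third !dvec_sum !mink_suml -sumrB.
by apply: eq_bigr => i _; rewrite [RHS]mulrBr !minkZl.
Qed.

(** A nondegenerate form on the finite dimensional tangent space represents every
    linear form; its Gram matrix in the coordinate vectors is inverted. *)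
Lemma first_minus_third_representable p (l : M -> R) :
  exists X, tangent p X /\ forall Y, tangent p Y -> first_minus_third X Y = Y l.
Proof.
have [c ac cp] := atlas_cover p; pose e i := coord_vector c p i.
have et i : tangent p (e i) by exact: coord_vector_tangent.
pose K : 'M[R]_n := \matrix_(i, j) first_minus_third (e i) (e j).
have comb (a : 'rV[R]_n) j :
    first_minus_third (fun h => \sum_i a 0 i * e i h) (e j) = (a *m K) 0 j.
  by rewrite first_minus_third_suml mxE; apply: eq_bigr => i _; rewrite mxE.
have all_dir X :
    (forall j, first_minus_third X (e j) = e j l) ->
    forall Y, tangent p Y -> first_minus_third X Y = Y l.
  move=> XE Y Yt; have [b ->] := tangent_span ac cp Yt.
  rewrite first_minus_thirdC first_minus_third_suml; apply: eq_bigr => j _.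
  by rewrite first_minus_thirdC XE.
(* A vector of the left kernel of the Gram matrix gives a degenerate tangent vector. *)
have Kunit : K \in unitmx.
  rewrite unitmxE unitfE; apply/negP => /det0P [v vn vK].
  have vt : tangent p (fun h => \sum_i v 0 i * e i h) by exact: tangent_lin.
  have v0 : (fun h => \sum_i v 0 i * e i h) = (fun=> 0).
    apply: (first_minus_third_nondegenerate vt) => Y Yt.
    have [b ->] := tangent_span ac cp Yt.
    rewrite first_minus_thirdC first_minus_third_suml big1 // => j _.
    by rewrite first_minus_thirdC comb vK mxE mulr0.
  have : \sum_i v 0 i *: dvec s (e i) = 0.
    by rewrite -dvec_sum v0; apply/rowP => k; rewrite !mxE.
  move/(frame_free (frame_det ac cp)) => vi.
  by move/negP: vn; apply; apply/eqP/rowP => i; rewrite vi mxE.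
pose a : 'rV[R]_n := (\row_j e j l) *m invmx K.
exists (fun h => \sum_i a 0 i * e i h); split; first exact: tangent_lin.
by apply: all_dir => j; rewrite comb /a mulmxKV // mxE.
Qed.

(** Near the point, a function of the Gauss map is a smooth extension of it
    composed with the lift, so the chain rule in a chart applies. *)
Lemma dgauss_dlift p X : tangent p X ->
  dgauss s nu p X = dgeod (lift_map s nu p) (dlift s nu X).
Proof.
move=> Xt; apply/funext => h; rewrite /dgauss /dgeod; case: asboolP => // hg.
set q := lift_map s nu p.
have [sm hs] := smooth_extensionP (lift_T1H p) hg.
set g := smooth_extension T1H q (h \o geod) in sm hs *.
have dg := smooth_near_differentiable sm.
have [c ac cp] := atlas_cover p.
have oc := chart_range_open ac; have uc := chart_range_map cp.
pose L u := (s (chart_inv c u), nu (chart_inv c u)).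
have Lu : L (chart_map c p) = q by rewrite /L chart_mapK.
have Ls : smooth_on (chart_range c) L.
  by move=> k; apply: Ck_pair => //; [exact: s_smooth|exact: nu_smooth].
have dL : differentiable L (chart_map c p) by have [H _] := Ls 1%N; exact: H.
have Lc : {for chart_map c p, continuous L} by exact: differentiable_continuous.
have near_hg : \forall u \near chart_map c p, g (L u) = (h \o gauss s nu) (chart_inv c u).
  have hs' : \forall y \near L (chart_map c p), T1H y -> (h \o geod) y = g y by rewrite Lu.
  have HL : \forall u \near chart_map c p, T1H (L u) -> (h \o geod) (L u) = g (L u) := Lc _ hs'.
  apply: filterS HL => u Hu.
  exact: (esym (Hu (lift_T1H (chart_inv c u)))).
have gLs : smooth_near (chart_map c p) (fun u => g (L u)).
  apply: (smooth_near_comp _ oc uc Ls); last by rewrite Lu.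
  by apply: finite_dim_pair; exact: finite_dim_rV.
have hgerm : smooth_germ p (h \o gauss s nu).
  exists c => //; split=> //.
  move: near_hg; rewrite /prop_near1 nbhsE => -[A [oA Ap] HA].
  exact: (smooth_near_eq oA Ap HA gLs).
have coordE i : coord_vector c p i (h \o gauss s nu) = 'D_(dlift s nu (coord_vector c p i)) g q.
  rewrite /coord_vector asboolT //.
  have dgL : differentiable g (L (chart_map c p)) by rewrite Lu.
  have [_] := is_derive_comp (delta_mx 0 i) dL dgL.
  rewrite Lu => E1.
  transitivity ('D_(delta_mx 0 i) (fun u => g (L u)) (chart_map c p)).
    apply: near_eq_derive; apply: filterS near_hg => u -> //.
  rewrite E1; congr ('D_ _ g q).
  have ds := diff_is_derive (delta_mx 0 i) ((s_smooth ac 1).1 _ uc).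
  have dn := diff_is_derive (delta_mx 0 i) ((nu_smooth ac 1).1 _ uc).
  have [_ ->] := is_derive_pair ds dn.
  have comp (F : M -> E) : (forall c, atlas c -> smooth_on (chart_range c) (F \o chart_inv c)) ->
      'D_(delta_mx 0 i) (F \o chart_inv c) (chart_map c p) = dvec F (coord_vector c p i).
    move=> Fs; apply/rowP => k; rewrite [RHS]mxE /coord_vector asboolT; last exact: map_vgerm.
    have dF := diff_is_derive (delta_mx 0 i) ((Fs c ac 1).1 _ uc).
    by have /is_derive_rVP /(_ k) [_ <-] := dF.
  by rewrite /dlift (comp s) // (comp nu).
have [a ->] := tangent_span ac cp Xt.
rewrite /dlift !dvec_sum.
have -> : (\sum_i a i *: dvec s (coord_vector c p i), \sum_i a i *: dvec nu (coord_vector c p i)) =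
   \sum_i a i *: (dlift s nu (coord_vector c p i)).
  by elim/big_rec3: _ => // i x y z _ <-.
rewrite deriveE // linear_sum; apply: eq_bigr => i _.
rewrite coordE linearZ /= -deriveE //.
Qed.

Lemma gauss_formE p X Y : tangent p X -> tangent p Y ->
  gauss_form s nu p X Y = first_minus_third X Y.
Proof.
move=> Xt Yt; rewrite /gauss_form !dgauss_dlift //.
by rewrite gmetric_dgeod //; [exact: lift_T1H|exact: dlift_chi_perp|exact: dlift_chi_perp].
Qed.

Lemma gauss_gradientP p (l : M -> R) :
  tangent p (gauss_gradient s nu l p) /\
  forall Y, tangent p Y -> first_minus_third (gauss_gradient s nu l p) Y = Y l.
Proof.
have [X [Xt XE]] := first_minus_third_representable p l.
have : tangent p (gauss_gradient s nu l p) /\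
  forall Y, tangent p Y -> gauss_form s nu p (gauss_gradient s nu l p) Y = Y l.
  apply: (@xgetPex _ _ [set X | tangent p X /\
             forall Y, tangent p Y -> gauss_form s nu p X Y = Y l]).
  by exists X; split=> // Y Yt; rewrite gauss_formE // XE.
by move=> [H1 H2]; split=> // Y Yt; rewrite -(gauss_formE H1 Yt) H2.
Qed.

(** Both sides have the same products with the vectors of the frame; for the
    tangent ones, <d nu (B X), d sigma e> = - <d nu X, d nu e> by self-adjointness,
    and the equality of the products becomes the defining property of [X]. *)
Lemma normal_velocity_eq c p X (l : M -> R) a d : atlas c -> chart_dom c p -> tangent p X ->
  (forall Y, tangent p Y -> first_minus_third X Y = Y l) ->
  mink (s p) d = - a -> mink (nu p) d = 0 ->
  (forall i, mink (dvec s (coord_vector c p i)) d = - coord_vector c p i l) ->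
  d = - dvec nu (shape_operator s nu p X) - dvec s X + a *: s p.
Proof.
move=> ac cp Xt XE sd nd ed; have [BXt BX] := shape_operatorP Xt.
have ns : mink (nu p) (s p) = 0 by rewrite minkC mink_sn.
apply/eqP; rewrite -subr_eq0; apply/eqP; apply: (frame_eq0 ac cp).
- by rewrite minkBr sd !minkDr minkZr !minkNr mink_s_dn // mink_s_ds // mink_ss; ring.
- by rewrite minkBr nd !minkDr minkZr !minkNr mink_n_dn // mink_n_ds // ns; ring.
move=> i; have it := coord_vector_tangent i ac cp; have ei := ed i.
set e := coord_vector c p i in it ei *.
have se : mink (dvec s e) (s p) = 0 by rewrite minkC mink_s_ds.
have BE : mink (dvec s e) (dvec nu (shape_operator s nu p X)) = - mink (dvec nu X) (dvec nu e).
  by rewrite minkC (second_form_symmetric BXt it) BX minkNr minkC.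
rewrite minkBr ei !minkDr minkZr !minkNr se BE -(XE _ it) /first_minus_third.
by rewrite [mink (dvec s e) _]minkC; ring.
Qed.

End HypersurfaceGeometry.

(** * The evolution formulas *)

Theorem proposition11p4p1 (R : realType) (n : nat) (M : oriented_manifold R n)
  (eps : R) (sigma nu : M -> R -> 'rV[R]_n.+2) (f : M -> R -> R)
  (eps_gt0 : 0 < eps)
  (sigma_smooth : smooth_family eps sigma)
  (sigma_hyp : forall (p : M) (t : R), - eps < t < eps -> hyperboloid (sigma p t))
  (sigma_imm : forall t : R, - eps < t < eps -> immersion (sigma^~ t))
  (nu_normal : forall t : R, - eps < t < eps ->
     unit_normal (sigma^~ t) (nu^~ t))
  (sigma_small : forall t : R, - eps < t < eps ->
     small_principal_curvatures (sigma^~ t) (nu^~ t))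
  (f_smooth : smooth_family eps f)
  (sigma_evol : forall (p : M) (t : R), - eps < t < eps ->
     is_derive t 1 (sigma p) (f p t *: nu p t)) :
  let zeta t := lift_map (sigma^~ t) (nu^~ t) in
  let dzeta t := dlift (sigma^~ t) (nu^~ t) in
  let G t := gauss (sigma^~ t) (nu^~ t) in
  let dG t := dgauss (sigma^~ t) (nu^~ t) in
  let B t := shape_operator (sigma^~ t) (nu^~ t) in
  let grad t := gauss_gradient (sigma^~ t) (nu^~ t) (f^~ t) in
  forall (p : M) (t : R), - eps < t < eps ->
    is_derive t 1 (fun s => zeta s p)
      (- dzeta t (B t p (grad t p)) - Jmap (dzeta t (grad t p))
       + f p t *: chi (zeta t p))
    /\
    has_velocity (fun s => G s p) t
      (- dG t p (B t p (grad t p)) - JJ (G t p) (dG t p (grad t p))).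
Proof.
move=> zeta dzeta G dG B grad p t te.
have nu_smooth := unit_normal_smooth sigma_smooth nu_normal.
have s_smooth c (ac : atlas c) := family_slice_smooth sigma_smooth te ac.
have n_smooth c (ac : atlas c) := family_slice_smooth nu_smooth te ac.
have s_hyp q : hyperboloid (sigma q t) := sigma_hyp q t te.
have s_imm := sigma_imm t te.
have s_nu := nu_normal t te.
have s_small := sigma_small t te.
have form_sym c q i j (ac : atlas c) (cq : chart_dom c q) :=
  second_form_sym sigma_smooth nu_normal i j ac cq te.
set X := grad t p.
have [Xt XE] : tangent p X /\ forall Y, tangent p Y ->
    first_minus_third (sigma^~ t) (nu^~ t) X Y = Y (f^~ t).
  exact: (gauss_gradientP s_smooth n_smooth s_hyp s_imm s_nu form_sym s_small).
have [BXt BX] : tangent p (B t p X) /\ dvec (sigma^~ t) (B t p X) = - dvec (nu^~ t) X.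
  exact: (shape_operatorP s_smooth n_smooth s_hyp s_nu).
have [c ac cp] := atlas_cover p.
have [d [dnu sd nd ed]] := normal_evolution sigma_smooth nu_normal f_smooth sigma_evol ac cp te.
have dE : d = - dvec (nu^~ t) (B t p X) - dvec (sigma^~ t) X + f p t *: sigma p t.
  exact: (normal_velocity_eq s_smooth n_smooth s_hyp s_imm s_nu form_sym ac cp Xt XE sd nd ed).
have dzetaE : is_derive t 1 (fun s => zeta s p)
  (- dzeta t (B t p X) - Jmap (dzeta t X) + f p t *: chi (zeta t p)).
  have ds := sigma_evol p t te.
  have := is_derive_pair ds dnu; rewrite dE.
  have -> : - dzeta t (B t p X) - Jmap (dzeta t X) + f p t *: chi (zeta t p) =
    (f p t *: nu p t,
     - dvec (nu^~ t) (B t p X) - dvec (sigma^~ t) X + f p t *: sigma p t); last by [].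
  congr (_, _) => /=.
  by rewrite BX opprK subrr add0r.
split=> //.
move=> h hg.
have Tt := lift_T1H s_hyp s_nu p.
have [sm hs] := smooth_extensionP Tt hg.
set q := zeta t p in Tt hg sm hs dzetaE *.
set g := smooth_extension T1H _ _ in sm hs *.
have dg := smooth_near_differentiable sm.
have zc : {for t, continuous (fun s => zeta s p)} by exact: is_derive_continuous1 dzetaE.
have near_h : \forall s \near t, h (G s p) = g (zeta s p).
  have Hs : \forall s \near t, T1H (zeta s p) -> (h \o geod) (zeta s p) = g (zeta s p) := zc _ hs.
  (* Only at times in the interval is the lift known to be in the unit tangent bundle. *)
  have te' : \forall s \near t, - eps < s < eps.
    case/andP: te => t1 t2.
    by apply: filterS2 (lt_nbhsr t1) (lt_nbhsl t2) => s -> ->.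
  apply: filterS2 te' Hs => s se; apply.
  exact: (lift_T1H (fun q => sigma_hyp q s se) (nu_normal s se)).
have value : (- dG t p (B t p X) - JJ (G t p) (dG t p X)) h =
    'D_(- dzeta t (B t p X) - Jmap (dzeta t X) + f p t *: chi q) g q.
  have gE Y : dgeod q Y h = 'D_Y g q by rewrite /dgeod asboolT.
  have dGE Y : tangent p Y -> dG t p Y = dgeod q (dzeta t Y).
    exact: (dgauss_dlift s_smooth n_smooth s_hyp s_imm s_nu).
  have -> : - dzeta t (B t p X) - Jmap (dzeta t X) + f p t *: chi q =
     f p t *: chi q + (-1 *: dzeta t (B t p X) + (-1 *: Jmap (dzeta t X) + 0)).
    by rewrite addrC !scaleN1r addr0.
  rewrite !derive_linear_dir // derive0 -!gE (dgeod_chi Tt) -(JJ_dgeod Tt); last first.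
    exact: (dlift_chi_perp s_smooth n_smooth s_hyp s_nu Xt).
  rewrite -!dGE //.
  have -> : (- dG t p (B t p X) - JJ (G t p) (dG t p X)) h =
    - (dG t p (B t p X) h) - JJ (G t p) (dG t p X) h by [].
  by rewrite scaler0 add0r !scaleN1r addr0.
rewrite value.
have D := is_derive_comp1 dzetaE dg.
apply: near_eq_is_derive D.
by apply: filterS near_h => s ->.
Qed.
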